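(* Let $P \subseteq \mathbb{R}^d$ be a $d$-dimensional polytope with vertices in $\mathbb{Z}^d$ and no integral points in its interior, such that for every rational line $g$ through the origin the set $P + g$ contains an integral point in its interior. Then $\operatorname{ld}(P) \le s_d - 1$, with equality if and only if $P$ is unimodularly equivalent to $S^d_0 = \operatorname{conv}(\{0, s_1e_1, \ldots, s_{d-1}e_{d-1}, (s_d-1)e_d\})$.
   Context: The Sylvester sequence: $s_1 = 2$, $s_i = \prod_{j=1}^{i-1} s_j + 1$ for $i\ge2$. The lattice diameter $\operatorname{ld}(P)$ is the maximum of $|P\cap\mathbb{Z}^d\cap g| - 1$ over all rational lines $g$. A line $g$ is rational if it is spanned by a rational vector. Unimodular equivalence: existence of an affine bijection of $\mathbb{R}^d$ preserving $\mathbb{Z}^d$ mapping one onto the other. *)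

(* Defs.v *)
From mathcomp Require Import all_boot.
From Stdlib Require Import Reals QArith Qreals ZArith.

Set Implicit Arguments. Unset Strict Implicit. Unset Printing Implicit Defensive.

Open Scope R_scope.

Definition vec (d : nat) := 'I_d -> R.

Definition sumR (n : nat) (f : 'I_n -> R) : R := \big[Rplus/0%R]_(i < n) f i.

(* Sylvester sequence.  sprod n = s_1 * ... * s_n (empty product = 1),
   s_n = s_1 * ... * s_(n-1) + 1 for n >= 1 (so s_1 = 2). *)
Fixpoint sprod (n : nat) : nat :=
  match n with
  | O => 1%nat
  | S m => (sprod m * (sprod m + 1))%nat
  end.
Definition sylvester (n : nat) : nat := (sprod (n - 1) + 1)%nat.

Definition integral {d} (x : vec d) : Prop := forall i, exists z : Z, x i = IZR z.
Definition rational_vec {d} (x : vec d) : Prop := forall i, exists q : Q, x i = Q2R q.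
Definition nonzero_vec {d} (x : vec d) : Prop := exists i, x i <> 0.

Definition conv {d m} (V : 'I_m -> vec d) (x : vec d) : Prop :=
  exists w : 'I_m -> R,
    (forall k, 0 <= w k) /\ sumR w = 1 /\
    (forall i, x i = sumR (fun k => w k * V k i)).

(* P is a lattice polytope: the convex hull of finitely many integral points
   (equivalently, a polytope all of whose vertices are integral). *)
Definition lattice_polytope {d} (P : vec d -> Prop) : Prop :=
  exists m (V : 'I_m -> vec d), (forall k, integral (V k)) /\
    (forall x, P x <-> conv V x).

Definition full_dimensional {d} (P : vec d -> Prop) : Prop :=
  exists p : 'I_d.+1 -> vec d, (forall k, P (p k)) /\
    (forall lam : 'I_d.+1 -> R,
        sumR lam = 0 -> (forall i, sumR (fun k => lam k * p k i) = 0) ->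
        forall k, lam k = 0).

Definition interiorRd {d} (P : vec d -> Prop) (x : vec d) : Prop :=
  exists eps, 0 < eps /\ forall y : vec d, (forall i, Rabs (y i - x i) < eps) -> P y.

Definition on_line {d} (a u : vec d) (x : vec d) : Prop :=
  exists t, forall i, x i = a i + t * u i.

Definition rational_dir {d} (u : vec d) : Prop := rational_vec u /\ nonzero_vec u.

Definition plus_line {d} (P : vec d -> Prop) (u : vec d) (x : vec d) : Prop :=
  exists y t, P y /\ forall i, x i = y i + t * u i.

Definition lattice_points_on {d} (P : vec d -> Prop) (a u : vec d) k (pts : 'I_k -> vec d) : Prop :=
  (forall j1 j2, pts j1 = pts j2 -> j1 = j2) /\
  (forall j, integral (pts j) /\ P (pts j) /\ on_line a u (pts j)).

Definition ld_le {d} (P : vec d -> Prop) (n : nat) : Prop :=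
  forall a u : vec d, rational_dir u ->
  forall k (pts : 'I_k -> vec d), lattice_points_on P a u pts -> (k <= n + 1)%nat.

Definition ld_ge {d} (P : vec d -> Prop) (n : nat) : Prop :=
  exists (a u : vec d) (pts : 'I_(n + 1) -> vec d),
    rational_dir u /\ lattice_points_on P a u pts.

Definition ld_eq {d} (P : vec d -> Prop) (n : nat) : Prop := ld_le P n /\ ld_ge P n.

Definition affine_map {d} (A : 'I_d -> 'I_d -> R) (b : vec d) (x : vec d) : vec d :=
  fun i => sumR (fun j => A i j * x j) + b i.

Definition unimod_equiv {d} (P Q : vec d -> Prop) : Prop :=
  exists (A : 'I_d -> 'I_d -> R) (b : vec d),
    let f := affine_map A b in
    (forall x y, f x = f y -> x = y) /\ (forall y, exists x, f x = y) /\
    (forall x, integral x <-> integral (f x)) /\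
    (forall y, Q y <-> exists x, P x /\ f x = y).

(* vertices of S^d_0 : vertex 0 is the origin, vertex i+1 is
   s_(i+1) e_(i+1) for i < d-1 and (s_d - 1) e_d for i = d-1 (0-based i). *)
Definition S0_vertex (d : nat) (k : 'I_d.+1) : vec d :=
  fun i =>
    if eqn (nat_of_ord k) (nat_of_ord i).+1 then
      (if eqn (nat_of_ord i).+1 d then INR (sylvester d - 1)%nat else INR (sylvester (nat_of_ord i).+1))
    else 0.

Definition S0 (d : nat) : vec d -> Prop := conv (@S0_vertex d).
Arguments S0 d : clear implicits.
Arguments S0_vertex d : clear implicits.

(* Main.v *)
From Stdlib Require Import Reals Qreals.
Require Import Defs.
From mathcomp Require Import all_boot all_order all_algebra.
From mathcomp Require Import zify ring lra.
From mathcomp Require Import boolp Rstruct.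

(** Let [p] and [p + l w] lie in [P], with [w] integral. The cylinder [P + R w]
    has an integral interior point, so modulo [w] some integral [z] is a positive
    combination of [p] and of vertices that are affinely independent modulo [w],
    hence of [k + 1 <= d] points. Moving [z] by multiples and integral translations
    one may take the coefficient [x0] of [p] maximal; a pigeonhole form of
    Minkowski's theorem then gives, for every set [J] of other coefficients,
    [prod_J x <= 1 - sum_J x], and these inequalities force
    [x0 >= 1 / (s_1 ... s_k)], with equality only if the other coefficients are the
    [1 / s_i]. The fiber of [P] over [z] has length at least [x0 l] and no integral
    point inside, whence [l <= 1 / x0 <= s_d - 1]. In the equality case the Chinese
    remainder theorem makes the [(v_i - p) / s_i] integral; since [P] is
    lattice-free, they form with [w] a basis of the lattice, and [P] is the
    resulting copy of [S0], all of whose facets contain integral points in their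
    relative interior. *)

Set Implicit Arguments. Unset Strict Implicit. Unset Printing Implicit Defensive.
Import Order.TTheory GRing.Theory Num.Theory.
Local Open Scope nat_scope.

(** * Integer weights *)

Lemma card_ord_lt n m : m <= n -> #|[pred y : 'I_n | y < m]| = m.
Proof.
by move=> le_mn; rewrite -sum1_card -(big_ord_widen n (fun=> 1)) // sum1_card card_ord.
Qed.

(* The index of the lattice {N a - (\sum a) X} in Z^J is N^(#|J| - 1) * R, and
   the pair (sum mod R, entries corrected by the quotient mod N) is a complete
   invariant of the classes; so a box with more points contains two congruent ones. *)
Lemma box_pigeonhole (I : finType) (X : I -> nat) (J : {set I}) (i0 : I) :
  (forall i, 0 < X i) -> i0 \notin J ->
  (\sum_i X i) ^ #|J| * (\sum_(i in ~: J) X i) < (\sum_i X i) * \prod_(i in J) X i ->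
  exists (n : nat) (a : I -> int) (X' : I -> nat),
    [/\ 0 < n, forall i, 0 < X' i, \sum_i X' i = \sum_i X i,
        forall i, i \notin J -> X' i = n.+1 * X i &
        forall i, ((X' i)%:Z = n.+1%:Z * (X i)%:Z + (\sum_i X i)%N%:Z * a i)%R].
Proof.
move=> X_gt0 i0J; set N := \sum_i X i; set R := \sum_(i in ~: J) X i => lt_vol.
have NE : N = \sum_(i in J) X i + R.
  rewrite /N (bigID (mem J)) /=; congr (_ + _).
  by apply: eq_bigl => i; rewrite inE.
have RE : \sum_(i | i \notin J) X i = R by apply: eq_bigl => i; rewrite inE.
have R_gt0 : 0 < R by rewrite /R (bigD1 i0) ?inE //= ltn_addr.
have X_le i : X i <= N by rewrite /N (bigD1 i) //= leq_addr.
have N_gt0 : 0 < N by rewrite NE ltn_addl.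
case: (set_0Vmem J) => [JE | [j0 j0J]].
  move: lt_vol; rewrite JE cards0 big_set0 expn0 mul1n muln1 NE JE big_set0.
  by rewrite add0n ltnn.
case: N NE X_le N_gt0 lt_vol => // N' NE X_le _ lt_vol.
case: R NE RE R_gt0 lt_vol => // R' NE RE _ lt_vol.
(* The box of all [Y] supported on [J] with [Y i < X i]; its cardinality is the product in the
   hypothesis. *)
pose B := pfamily (ord0 : 'I_N'.+1) (mem J) (fun i => [pred y : 'I_N'.+1 | y < X i]).
have cardB : #|B| = \prod_(i in J) X i.
  rewrite card_pfamily foldrE big_image /=; apply: eq_bigr => i _.
  by rewrite card_ord_lt.
pose S (Y : {ffun I -> 'I_N'.+1}) := \sum_(i in J) (Y i : nat).
pose q Y := S Y %/ R'.+1.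
(* The entry at [j0] is left out, since the sum over [J] determines it modulo N. Hence [f] takes at
   most R * N ^ (#|J| - 1) values, fewer than the box has points. *)
pose f (Y : {ffun I -> 'I_N'.+1}) : 'I_R'.+1 * {ffun I -> 'I_N'.+1} :=
  (inord (S Y %% R'.+1),
   [ffun i => if i \in J :\ j0 then inord ((Y i + q Y * X i) %% N'.+1) else ord0]).
have: ~~ dinjectiveb f (mem B).
  apply/negP => /dinjectiveP /card_in_imset cardf.
  have : #|f @: B| <= #|setX [set: 'I_R'.+1]
      [set Z in pffun_on (ord0 : 'I_N'.+1) (mem (J :\ j0)) predT]|.
    apply: subset_leq_card; apply/subsetP => _ /imsetP [Y _ ->].
    rewrite !inE /=; apply/pffun_onP; split=> //.
    apply/supportP => i iJ; rewrite ffunE; case: ifP => // iJ'.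
    by case/negP: iJ.
  rewrite cardf cardB cardsX cardsT cardsE card_pffun_on card_ord.
  have -> : #|'I_N'.+1 : predArgType| = N'.+1 by rewrite card_ord.
  move=> le_vol; move: lt_vol; rewrite ltnNge (cardsD1 j0 J) j0J add1n expnS.
  by rewrite -mulnA leq_mul2l /= mulnC le_vol.
case/dinjectivePn => Y YB [Y' /andP [YY' Y'B]] fY.
have {}YY' : Y != Y' by rewrite eq_sym; exact: YY'.
have {}Y'B : Y' \in mem B by exact: Y'B.
move: (Y : {ffun I -> 'I_N'.+1}) (Y' : {ffun I -> 'I_N'.+1}) YB Y'B YY' fY => {}Y {}Y' YB Y'B YY' fY.
wlog le_q : Y Y' YB Y'B YY' fY / q Y <= q Y'.
  case/orP: (leq_total (q Y) (q Y')) => le_q W; first exact: (W Y Y').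
  by apply: (W Y' Y) => //; rewrite eq_sym.
have BP (Z : {ffun I -> 'I_N'.+1}) : Z \in B -> (forall i, i \in J -> Z i < X i) /\
    (forall i, i \notin J -> Z i = ord0).
  case/pfamilyP => /supportP supp ltZ; split=> i iJ; first exact: ltZ.
  exact: supp.
have [ltY Y0] := BP _ YB; have [ltY' Y'0] := BP _ Y'B.
have eqrho : S Y %% R'.+1 = S Y' %% R'.+1.
  by have := congr1 (fun z : 'I_R'.+1 * {ffun I -> 'I_N'.+1} => z.1 : nat) fY; rewrite /= !inordK // ltn_mod.
have eq1 i : i \in J :\ j0 -> Y i + q Y * X i = Y' i + q Y' * X i %[mod N'.+1].
  move=> iJ; have := congr1 (fun z : 'I_R'.+1 * {ffun I -> 'I_N'.+1} => z.2 i : nat) fY.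
  by rewrite /= !ffunE iJ !inordK // ltn_mod.
(* As [X] sums to N - R over [J], the corrected entries sum to the remainder of [S Z] modulo N; this
   yields the congruence at [j0] from the others. *)
have sumq (Z : {ffun I -> 'I_N'.+1}) : \sum_(i in J) (Z i + q Z * X i) = q Z * N'.+1 + S Z %% R'.+1.
  rewrite big_split /= -big_distrr /= -/(S Z) [X in X + _](divn_eq (S Z) R'.+1).
  by rewrite -/(q Z) NE; lia.
have eq2 i : i \in J -> Y i + q Y * X i = Y' i + q Y' * X i %[mod N'.+1].
  case: (eqVneq i j0) => [-> _ | ij iJ]; last by apply: eq1; rewrite !inE ij.
  have sumeq : \sum_(i in J :\ j0) (Y i + q Y * X i) =
      \sum_(i in J :\ j0) (Y' i + q Y' * X i) %[mod N'.+1].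
    pose K u v := u = v %[mod N'.+1].
    apply: (@big_ind2 _ _ K) => // u1 u2 v1 v2 eq_u eq_v.
    by rewrite /K -modnDm eq_u eq_v modnDm.
  have tot : \sum_(i in J) (Y i + q Y * X i) =
      \sum_(i in J) (Y' i + q Y' * X i) %[mod N'.+1].
    by rewrite !sumq eqrho !modnMDl.
  move: tot; rewrite 2!(big_setD1 j0 j0J) /= -modnDmr sumeq modnDmr => /eqP.
  by rewrite eqn_modDr => /eqP.
(* With equal quotients, [Y] and [Y'] would be congruent modulo N entry by entry, hence equal, all
   entries being below N. *)
have lt_q : q Y < q Y'.
  rewrite ltn_neqAle le_q andbT; apply/negP => /eqP eq_q.
  case/negP: YY'; apply/eqP/ffunP => i; case: (boolP (i \in J)) => iJ; last first.
    by rewrite Y0 // Y'0.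
  apply: val_inj => /=; have := eq2 _ iJ; rewrite eq_q => /eqP.
  by rewrite eqn_modDr !modn_small // => /eqP.
pose n := q Y' - q Y.
have dvdZ i : i \in J ->
    (Posz N'.+1 %| (Posz (Y i) - Posz (Y' i) - Posz n * Posz (X i))%R)%Z.
  move=> iJ; have := eq2 _ iJ; move/eqP; rewrite -eqz_nat -!modz_nat eqz_mod_dvd.
  congr (_ %| _)%Z; rewrite /n; lia.
pose a i : int := if i \in J then
  ((Posz (Y i) - Posz (Y' i) - Posz n * Posz (X i))%R %/ Posz N'.+1)%Z else 0%R.
(* The subtraction does not truncate, because [Y' i < X i]. The sum over [J] drops by n R, exactly
   what the other entries gain. *)
pose X' i := if i \in J then X i + Y i - Y' i else n.+1 * X i.
exists n, a, X'; split.
- by rewrite subn_gt0.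
- move=> i; rewrite /X'; case: ifP => iJ; last by rewrite muln_gt0 X_gt0.
  by have := ltY' _ iJ; lia.
- rewrite (bigID (mem J)) /=.
  have -> : \sum_(i | i \notin J) X' i = n.+1 * R'.+1.
    rewrite -RE.
    by rewrite big_distrr; apply: eq_bigr => i /negbTE iJ; rewrite /X' iJ.
  have E : \sum_(i in J) X' i + S Y' = \sum_(i in J) X i + S Y.
    rewrite -!big_split /=; apply: eq_bigr => i iJ; rewrite /X' iJ.
    by have := ltY' _ iJ; lia.
  have SE (Z : {ffun I -> 'I_N'.+1}) : S Z = q Z * R'.+1 + S Z %% R'.+1 by exact: divn_eq.
  by move: E; rewrite (SE Y) (SE Y') eqrho NE /n; nia.
- by move=> i /negbTE iJ; rewrite /X' iJ.
- move=> i; rewrite /X' /a; case: ifP => iJ; last by lia.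
  have := divzK (dvdZ _ iJ); have := ltY' _ iJ.
  move: (_ %/ _)%Z => b; lia.
Qed.

(** As long as some [J] violates the inequality, [box_pigeonhole] at least doubles [X i0], which
    never exceeds N, so the process stops. With x = X / N the inequality reads prod_J x <= 1 - sum_J
    x. The predicate [good] stands for what the moves preserve, later the integrality of a point
    modulo a line. *)
Lemma exists_product_sum (I : finType) (i0 : I) (N : nat)
    (good : (I -> nat) -> Prop) (X : I -> nat) :
  (forall X X' n (a : I -> int), good X ->
     (forall i, ((X' i)%:Z = n.+1%:Z * (X i)%:Z + N%:Z * a i)%R) -> good X') ->
  good X -> (forall i, 0 < X i) -> \sum_i X i = N ->
  exists X' : I -> nat,
    [/\ good X', forall i, 0 < X' i, \sum_i X' i = N &
        forall J : {set I}, i0 \notin J ->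
          N * \prod_(i in J) X' i <= N ^ #|J| * \sum_(i in ~: J) X' i].
Proof.
move=> good_step; have [m] := ubnP (N - X i0).
elim: m X => // m IHm X lt_m goodX X_gt0 sumX.
case: (boolP [forall J : {set I}, (i0 \notin J) ==>
    (N * \prod_(i in J) X i <= N ^ #|J| * \sum_(i in ~: J) X i)]) => [maxX|].
  exists X; split=> // J i0J.
  by move/forallP/(_ J): maxX; rewrite i0J.
rewrite negb_forall => /existsP [J]; rewrite negb_imply -ltnNge => /andP [i0J lt_vol].
rewrite -{1 2}sumX in lt_vol.
have [n [a [X' [n_gt0 X'_gt0 sumX' X'E X'Z]]]] := box_pigeonhole X_gt0 i0J lt_vol.
apply: (IHm X') => //.
- have X'_le : X' i0 <= N by rewrite -sumX -sumX' (bigD1 i0) //= leq_addr.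
  have := X'E _ i0J; have := X_gt0 i0; nia.
- by apply: (good_step X _ n a) => // i; rewrite X'Z sumX.
- by rewrite sumX'.
Qed.

(** * Sylvester numbers *)

#[local] Arguments sprod : simpl never.

Lemma sprodS n : sprod n.+1 = sprod n * (sprod n).+1.
Proof. by rewrite -[(sprod n).+1]addn1. Qed.

Lemma sprod_gt0 n : 0 < sprod n.
Proof. by elim: n => // n IHn; rewrite sprodS muln_gt0 IHn. Qed.

Lemma leq_sprod m n : m <= n -> sprod m <= sprod n.
Proof.
elim: n => [|n IHn]; first by case: m.
rewrite leq_eqVlt => /orP [/eqP -> //|/IHn le_mn].
by rewrite sprodS; apply: leq_trans le_mn _; rewrite leq_pmulr.
Qed.

Lemma ltn_sprod m n : m < n -> sprod m < sprod n.
Proof.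
move/leq_sprod; apply: leq_trans.
by rewrite sprodS ltn_Pmulr ?sprod_gt0 // ltnS sprod_gt0.
Qed.

(** Indices start at 0 from here on, so that s_(i+1) is written [(sprod i).+1]. *)
Lemma prod_sylvester n : \prod_(i < n) (sprod i).+1 = sprod n.
Proof.
by elim: n => [|n IHn]; [rewrite big_ord0 | rewrite big_ord_recr /= IHn -sprodS].
Qed.

Lemma coprime_sylvester i j : i != j -> coprime (sprod i).+1 (sprod j).+1.
Proof.
wlog lt_ij : i j / i < j.
  move=> W; rewrite neq_ltn => /orP [] lt_ij; last rewrite coprime_sym;
  by apply: W => //; rewrite neq_ltn lt_ij.
move=> _; rewrite /coprime.
have /dvdnP [c ->] : (sprod i).+1 %| sprod j.
  rewrite -(prod_sylvester j).
  by rewrite (bigD1 (Ordinal lt_ij)) //= dvdn_mulr.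
by rewrite -[(c * _).+1]addn1 gcdnMDl gcdn1.
Qed.

Section SylvesterInequality.
Local Open Scope ring_scope.
Variable F : realFieldType.

(** The sum telescopes: 1 / (p + 1) = 1 / p - 1 / (p (p + 1)). *)
Lemma sum_inv_sylvester n :
  \sum_(i < n) ((sprod i).+1%:R : F)^-1 = 1 - (sprod n)%:R^-1.
Proof.
elim: n => [|n IHn]; first by rewrite big_ord0 invr1 subrr.
rewrite big_ord_recr /= IHn sprodS natrM -natr1.
have p_gt0 : 0 < (sprod n)%:R :> F by rewrite ltr0n sprod_gt0.
by field; apply/andP; split; rewrite gt_eqF //; lra.
Qed.

Lemma abel_ge0 (c e : nat -> F) n :
  (forall i, (i < n)%N -> 0 <= c i) ->
  (forall i, (i.+1 < n)%N -> c i <= c i.+1) ->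
  (forall j, (j <= n)%N -> 0 <= \sum_(j <= i < n) e i) ->
  0 <= \sum_(0 <= i < n) c i * e i.
Proof.
case: n => [|n] c_ge0 c_mono e_ge0; first by rewrite big_nil.
(* Induction on the length of the tail: lowering all its coefficients to the first one can only
   decrease the sum, because the tail sums of [e] are nonnegative. *)
have main m : (m <= n)%N ->
    c (n - m)%N * \sum_(n - m <= i < n.+1) e i <= \sum_(n - m <= i < n.+1) c i * e i.
  elim: m => [|m IHm] lt_mn; first by rewrite subn0 !big_nat1.
  have E : (n - m = (n - m.+1).+1)%N by lia.
  have lt1 : ((n - m.+1) < n.+1)%N by lia.
  rewrite !(big_ltn lt1) -E mulrDr lerD2l.
  apply: le_trans (IHm _); last by lia.
  by apply: ler_wpM2r; [apply: e_ge0; lia | rewrite E; apply: c_mono; lia].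
have := main n (leqnn n); rewrite subnn; apply: le_trans.
by rewrite mulr_ge0 ?c_ge0 ?e_ge0.
Qed.

(** Equality case of AM-GM: the mean is at most 1 and the product at least 1, so all the [t i]
    coincide. *)
Lemma prod_ge1_sum_le (n : nat) (t : 'I_n -> F) :
  (forall i, 0 < t i) -> \sum_i t i <= n%:R -> 1 <= \prod_i t i ->
  forall i, t i = 1.
Proof.
move=> t_gt0 sum_t prod_t i.
have n_gt0 : (0 < n)%N by case: n i {t t_gt0 sum_t prod_t} => // - [].
have := @leif_AGM F 'I_n predT t (fun j _ => ltW (t_gt0 j)).
rewrite /= card_ord => - [AG].
have mu_ge0 : 0 <= (\sum_i t i) / n%:R.
  by rewrite divr_ge0 ?ler0n // sumr_ge0 // => j _; exact: ltW.
have le1 : ((\sum_i t i) / n%:R) ^+ n <= 1.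
  by rewrite exprn_ile1 // ler_pdivrMr ?ltr0n // mul1r.
have -> : \prod_j t j = ((\sum_i t i) / n%:R) ^+ n.
  by apply/eqP; rewrite eq_le AG (le_trans le1).
rewrite eqxx => /esym /forall_inP eq_t.
have tE j : t j = t i by move/forall_inP: (eq_t j isT) => /(_ i isT) /eqP.
move: prod_t sum_t; rewrite (eq_bigr (fun=> t i)) // prodr_const card_ord.
rewrite (eq_bigr (fun=> t i)) // sumr_const card_ord => prod_t.
rewrite -[_ *+ n]mulr_natr -{2}[n%:R]mul1r ler_pM2r ?ltr0n // => t_le1.
apply/eqP; rewrite eq_le t_le1 /= leNgt; apply/negP => t_lt1.
by move: prod_t; rewrite leNgt (exprn_ilt1 _ (ltW (t_gt0 i)) t_lt1) -lt0n n_gt0.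
Qed.

(* If x_1 + ... + x_k reached the sum of the 1 / s_i, every tail of x would dominate
   the tail of 1 / s; by Abel summation and AM-GM so would the product. *)
Lemma sylvester_inequality (x : nat -> F) k :
  (forall i, (i < k)%N -> 0 < x i) ->
  (forall i, (i.+1 < k)%N -> x i.+1 <= x i) ->
  (forall j, (j <= k)%N -> \prod_(i < j) x i <= 1 - \sum_(i < j) x i) ->
  1 - \sum_(i < k) x i <= (sprod k)%:R^-1 ->
  forall i, (i < k)%N -> x i = (sprod i).+1%:R^-1.
Proof.
have [m] := ubnP k; elim: m k => // m IHm k lt_km x_gt0 x_mono x_prod x_sum.
pose y i : F := (sprod i).+1%:R^-1.
have y_gt0 i : 0 < y i by rewrite invr_gt0 ltr0n.
(* A prefix on which [x] had the larger sum would satisfy the hypotheses with [j] in place of [k];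
   by induction [x] and [y] would agree on it. *)
have prefix j : (j < k)%N -> \sum_(i < j) x i <= \sum_(i < j) y i.
  move=> lt_jk; rewrite leNgt; apply/negP => lt_xy.
  have xE : forall i, (i < j)%N -> x i = y i.
    apply: IHm => [|i lt_ij|i lt_ij|i le_ij|].
    - by apply: leq_trans lt_jk _.
    - by apply: x_gt0; apply: ltn_trans lt_jk.
    - by apply: x_mono; apply: ltn_trans lt_jk.
    - by apply: x_prod; apply: leq_trans (ltnW lt_jk).
    - by move: lt_xy; rewrite sum_inv_sylvester; lra.
  have sumE : \sum_(i < j) x i = \sum_(i < j) y i by apply: eq_bigr => i _; exact: xE.
  by move: lt_xy; rewrite sumE ltxx.
have total : \sum_(i < k) y i <= \sum_(i < k) x i.
  by rewrite sum_inv_sylvester; move: x_sum; lra.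
(* Abel summation of the nondecreasing 1 / x i against x i - y i, whose tail sums are nonnegative by
   [prefix] and [total]. *)
have le_k : \sum_(i < k) y i / x i <= k%:R.
  rewrite -subr_ge0 -[k in k%:R]card_ord -sumr_const -sumrB.
  have -> : \sum_(i < k) (1 - y i / x i) = \sum_(0 <= i < k) (x i)^-1 * (x i - y i).
    rewrite big_mkord; apply: eq_bigr => i _.
    by rewrite mulrBr mulVf ?gt_eqF ?x_gt0 // mulrC.
  apply: (@abel_ge0 (fun i => (x i)^-1)) => [i ?|i lt_ik|j le_jk].
  - by rewrite invr_ge0 ltW ?x_gt0.
  - by rewrite lef_pV2 ?posrE ?x_mono ?x_gt0 // ltnW.
  - rewrite -(lerD2l (\sum_(0 <= i < j) (x i - y i))) -big_cat_nat //= addr0.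
    rewrite !big_mkord !sumrB.
    case: (ltngtP j k) le_jk => [lt_jk _|//|-> _]; last by [].
    by move: (prefix _ lt_jk) total; lra.
move=> i lt_ik; suff /(_ (Ordinal lt_ik)) /= yx :
    forall i : 'I_k, y i / x i = 1.
  by rewrite -(divr1_eq yx).
apply: prod_ge1_sum_le => // [j|]; first by rewrite divr_gt0 ?x_gt0.
rewrite prodf_div ler_pdivlMr ?mul1r; last by apply: prodr_gt0 => j _; rewrite x_gt0.
apply: le_trans (x_prod k (leqnn k)) _; apply: le_trans x_sum _.
by rewrite prodfV -natr_prod prod_sylvester.
Qed.

End SylvesterInequality.

(** Sorting the other weights in decreasing order and taking initial segments for [J] gives the
    hypotheses of [sylvester_inequality]. If [X i0] were too small, the others would be the N / s_i,
    which leave exactly N / (s_1 ... s_k) for [X i0], a contradiction. *)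
Lemma product_sum_sylvester (I : finType) (i0 : I) (X : I -> nat) (N := \sum_i X i) :
  (forall i, 0 < X i) ->
  (forall J : {set I}, i0 \notin J ->
     N * \prod_(i in J) X i <= N ^ #|J| * \sum_(i in ~: J) X i) ->
  N <= X i0 * sprod #|I|.-1 /\
  (X i0 * sprod #|I|.-1 <= N ->
   exists2 s : seq I, perm_eq s (enum (predC1 i0)) &
     forall i, i < #|I|.-1 -> X (nth i0 s i) * (sprod i).+1 = N).
Proof.
move=> X_gt0 X_prod; set k := #|I|.-1.
pose leX a b := X b <= X a.
pose s := sort leX (enum (predC1 i0)).
have s_perm : perm_eq s (enum (predC1 i0)) by rewrite perm_sort.
have s_uniq : uniq s by rewrite (perm_uniq s_perm) enum_uniq.
have i0s : i0 \notin s by rewrite (perm_mem s_perm) mem_enum inE /= eqxx.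
have s_size : size s = k.
  by rewrite (perm_size s_perm) -cardE cardC1.
have s_sorted : sorted leX s by apply: sort_sorted => a b; exact: leq_total.
have N_gt0 : 0 < N by rewrite /N (bigD1 i0) //= ltn_addr.
pose x i : rat := ((X (nth i0 s i))%:R / N%:R)%R.
have N_neq0 : (N%:R != 0 :> rat)%R by rewrite pnatr_eq0 -lt0n.
have x_gt0 i : i < k -> (0 < x i)%R by rewrite divr_gt0 ?ltr0n.
have x_mono i : i.+1 < k -> (x i.+1 <= x i)%R.
  move=> lt_ik; rewrite ler_pM2r ?invr_gt0 ?ltr0n // ler_nat.
  by move/(sortedP i0): s_sorted => /(_ i); rewrite s_size => /(_ lt_ik).
pose T j := [set i in take j s].
have T_uniq j : uniq (take j s) by rewrite take_uniq.
have big_T (R : Type) (idx : R) (op : Monoid.com_law idx) (G : I -> R) j : j <= k ->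
    \big[op/idx]_(i in T j) G i = \big[op/idx]_(i < j) G (nth i0 s i).
  move=> le_jk; rewrite (eq_bigl (mem (take j s))); last by move=> i; rewrite inE.
  rewrite -big_uniq // (big_nth i0) size_takel ?s_size // big_mkord.
  by apply: eq_bigr => i _; rewrite nth_take.
have cardT j : j <= k -> #|T j| = j.
  by move=> le_jk; rewrite -sum1_card big_T // sum1_card card_ord.
have T_compl j : j <= k ->
    (1 - \sum_(i < j) x i = (\sum_(i in ~: T j) X i)%N%:R / N%:R)%R.
  move=> le_jk; rewrite -mulr_suml -natr_sum -(big_T _ _ _ X) //.
  have NE : N = \sum_(i in T j) X i + \sum_(i in ~: T j) X i.
    rewrite /N (bigID (mem (T j))) /=; congr (_ + _).
    by apply: eq_bigl => i; rewrite in_setC.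
  by rewrite -{1}(divff N_neq0) -mulrBl {1}NE natrD addrC addKr.
have x_prod j : j <= k -> (\prod_(i < j) x i <= 1 - \sum_(i < j) x i)%R.
  move=> le_jk; rewrite T_compl // prodf_div prodr_const card_ord.
  rewrite -natr_prod -(big_T _ _ _ X) // ler_pdivrMr ?exprn_gt0 ?ltr0n //.
  rewrite mulrAC ler_pdivlMr ?ltr0n // -natrX -!natrM ler_nat.
  have i0T : i0 \notin T j by rewrite inE; apply: contra i0s => /mem_take.
  by have := X_prod _ i0T; rewrite cardT // mulnC [X in _ <= X]mulnC.
have x_last : (1 - \sum_(i < k) x i = (X i0)%:R / N%:R)%R.
  rewrite T_compl //; congr (_ %:R / _)%R.
  have TE : ~: T k = [set i0].
    apply/setP => i; rewrite !inE -s_size take_size (perm_mem s_perm) mem_enum inE.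
    by rewrite negbK.
  by rewrite TE big_set1.
have p_gt0 : (0 < (sprod k)%:R :> rat)%R by rewrite ltr0n sprod_gt0.
have xE : X i0 * sprod k <= N ->
    forall i, i < k -> (x i = (sprod i).+1%:R^-1)%R.
  move=> le_N; apply: sylvester_inequality => //.
  rewrite x_last ler_pdivrMr ?ltr0n // mulrC ler_pdivlMr //.
  by rewrite -natrM ler_nat.
split=> [|le_N].
  rewrite leqNgt; apply/negP => lt_N.
  have sumE : (\sum_(i < k) x i = \sum_(i < k) (sprod i).+1%:R^-1)%R.
    by apply: eq_bigr => i _; apply: xE => //; exact: ltnW.
  move: x_last; rewrite sumE sum_inv_sylvester => /eqP.
  rewrite opprB addrC subrK eq_sym -[X in _ == X]div1r eqr_div ?pnatr_eq0 -?lt0n ?sprod_gt0 //.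
  by rewrite mul1r -natrM eqr_nat => /eqP E; rewrite E ltnn in lt_N.
exists s => // i lt_ik; apply/eqP; rewrite -(eqr_nat rat) natrM.
have := xE le_N i lt_ik; rewrite /x => /eqP.
by rewrite -[X in _ == X]div1r eqr_div ?pnatr_eq0 -?lt0n // mul1r.
Qed.

Lemma sylvester_reduction (I : finType) (i0 : I) (N : nat)
    (good : (I -> nat) -> Prop) (X : I -> nat) :
  (forall X X' n (a : I -> int), good X ->
     (forall i, ((X' i)%:Z = n.+1%:Z * (X i)%:Z + N%:Z * a i)%R) -> good X') ->
  good X -> (forall i, 0 < X i) -> \sum_i X i = N ->
  exists X' : I -> nat,
    [/\ good X', forall i, 0 < X' i, \sum_i X' i = N, N <= X' i0 * sprod #|I|.-1 &
        X' i0 * sprod #|I|.-1 <= N ->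
        exists2 s : seq I, perm_eq s (enum (predC1 i0)) &
          forall i, i < #|I|.-1 -> X' (nth i0 s i) * (sprod i).+1 = N].
Proof.
move=> good_step goodX X_gt0 sumX.
have [X' [goodX' X'_gt0 sumX' X'_prod]] := exists_product_sum i0 good_step goodX X_gt0 sumX.
rewrite -sumX' in X'_prod; have [le_N eq_N] := product_sum_sylvester X'_gt0 X'_prod.
by exists X'; split; rewrite // -sumX'.
Qed.

Local Open Scope ring_scope.

(** * Convexity *)

Section Convexity.
Variables (F : archiRealFieldType) (d : nat).
Implicit Types (P : 'rV[F]_d -> Prop) (x y p q v w : 'rV[F]_d).

Definition convex_closed P :=
  forall (I : finType) (c : I -> F) (u : I -> 'rV[F]_d),
    (forall i, 0 <= c i) -> \sum_i c i = 1 -> (forall i, P (u i)) ->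
    P (\sum_i c i *: u i).

Definition inner P x :=
  exists2 e : F, 0 < e & forall y, (forall i, `|y 0 i - x 0 i| < e) -> P y.

Lemma convex_closed2 P x y t :
  convex_closed P -> P x -> P y -> 0 <= t <= 1 -> P (t *: x + (1 - t) *: y).
Proof.
move=> cvxP Px Py /andP [t_ge0 t_le1].
have := cvxP bool (fun b => if b then t else 1 - t) (fun b => if b then x else y).
rewrite !big_bool /=; apply; [by case; lra | lra | by case].
Qed.

Lemma convex_closed_cons P n p (c : 'I_n -> F) (u : 'I_n -> 'rV[F]_d) :
  convex_closed P -> P p -> (forall i, P (u i)) -> (forall i, 0 <= c i) ->
  \sum_i c i <= 1 -> P ((1 - \sum_i c i) *: p + \sum_i c i *: u i).
Proof.
move=> cvxP Pp Pu c_ge0 c_le1.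
have := cvxP _ (oapp c (1 - \sum_i c i) \o unlift ord0) (oapp u p \o unlift ord0).
rewrite !big_ord_recl /= unlift_none /= => H.
rewrite (eq_bigr (fun i : 'I_n => c i *: u i)) in H; last by move=> i _; rewrite liftK.
apply: H => [i||i].
- by case: unliftP => [j|] _ /=; rewrite ?subr_ge0.
- by rewrite [X in _ + X](eq_bigr c) ?subrK // => i _; rewrite liftK.
- by case: unliftP => [j|] _ /=.
Qed.

(** The homothety with center [q] and ratio [t] maps a ball around [y] onto a ball around the
    mixture. *)
Lemma inner_mix P y q t :
  convex_closed P -> inner P y -> P q -> 0 < t <= 1 -> inner P (t *: y + (1 - t) *: q).
Proof.
move=> cvxP [e e_gt0 Py] Pq /andP [t_gt0 t_le1].
exists (t * e); first by rewrite mulr_gt0.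
move=> x x_near; have t_neq0 : t != 0 by rewrite gt_eqF.
have -> : x = t *: (t^-1 *: (x - (1 - t) *: q)) + (1 - t) *: q.
  by rewrite scalerA divff // scale1r subrK.
apply: convex_closed2 => //; last by rewrite ltW.
apply: Py => i; rewrite !mxE.
have -> : t^-1 * (x 0 i - (1 - t) * q 0 i) - y 0 i =
    t^-1 * (x 0 i - (t * y 0 i + (1 - t) * q 0 i)) by field.
rewrite normrM gtr0_norm ?invr_gt0 // mulrC ltr_pdivrMr // [e * t]mulrC.
by have := x_near i; rewrite !mxE.
Qed.

Lemma inner_extend P y v : inner P y -> exists2 t, 0 < t & P (y + t *: v).
Proof.
case=> e e_gt0 Py; pose s := 1 + \sum_i `|v 0 i|.
have s_gt0 : 0 < s by rewrite ltr_pwDl ?sumr_ge0.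
exists (e / s); first by rewrite divr_gt0.
apply: Py => i; rewrite !mxE addrAC subrr add0r normrM gtr0_norm ?divr_gt0 //.
rewrite mulrAC ltr_pdivrMr // ltr_pM2l // /s (bigD1 i) //=.
by rewrite addrCA ltrDl ltr_pwDl ?sumr_ge0.
Qed.

(** The inverse of 1 + sum 1 / f replaces a minimum and also covers an empty index type. *)
Lemma positive_lower_bound (I : finType) (f : I -> F) :
  (forall i, 0 < f i) -> exists2 e, 0 < e & forall i, e <= f i.
Proof.
move=> f_gt0; have s_gt0 : 0 < 1 + \sum_i (f i)^-1.
  by rewrite ltr_pwDl ?sumr_ge0 // => i _; rewrite invr_ge0 ltW.
exists (1 + \sum_i (f i)^-1)^-1; first by rewrite invr_gt0.
move=> i; rewrite -[leRHS]invrK lef_pV2 ?posrE ?invr_gt0 // (bigD1 i) //=.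
rewrite addrCA lerDl addr_ge0 // sumr_ge0 // => j _.
by rewrite invr_ge0 ltW.
Qed.

(** The vertex p + s_i b_i receives the barycentric coordinate y_i / s_i, and [p] the remaining
    weight. *)
Lemma simplex_sub P p (B : 'M[F]_d) (s : 'I_d -> F) y :
  convex_closed P -> (forall i, 0 < s i) -> P p -> (forall i, P (p + s i *: row i B)) ->
  (forall i, 0 <= y 0 i) -> \sum_i y 0 i / s i <= 1 -> P (p + y *m B).
Proof.
move=> cvxP s_gt0 Pp Ps y_ge0 y_le1.
have -> : p + y *m B = (1 - \sum_i y 0 i / s i) *: p +
    \sum_i (y 0 i / s i) *: (p + s i *: row i B).
  under [X in _ = _ + X]eq_bigr => i _.
    rewrite scalerDr scalerA divfK ?gt_eqF //; over.
  rewrite big_split /= -scaler_suml -mulmx_sum_row addrA -scalerDl subrK.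
  by rewrite scale1r.
apply: convex_closed_cons => // i; apply: divr_ge0 => //; exact: ltW.
Qed.

Lemma inner_simplex P p (B : 'M[F]_d) (s : 'I_d -> F) y :
  convex_closed P -> B \in unitmx -> (forall i, 0 < s i) ->
  P p -> (forall i, P (p + s i *: row i B)) ->
  (forall i, 0 < y 0 i) -> \sum_i y 0 i / s i < 1 -> inner P (p + y *m B).
Proof.
move=> cvxP B_unit s_gt0 Pp Ps y_gt0 y_lt1.
have [e1 e1_gt0 e1_le] := positive_lower_bound y_gt0.
pose S := 1 + \sum_i (s i)^-1.
have S_gt0 : 0 < S by rewrite ltr_pwDl ?sumr_ge0 // => i _; rewrite invr_ge0 ltW.
pose e2 := (1 - \sum_i y 0 i / s i) / S.
have e2_gt0 : 0 < e2 by rewrite divr_gt0 ?subr_gt0.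
(* [e1] keeps the coordinates nonnegative, [e2] keeps their weighted sum at most 1, and [C] bounds
   how much [invmx B] enlarges a perturbation. *)
pose e3 := Num.min e1 e2.
have e3_gt0 : 0 < e3 by rewrite lt_min e1_gt0.
pose C := 1 + \sum_i \sum_j `|invmx B j i|.
have C_gt0 : 0 < C.
  by rewrite ltr_pwDl // sumr_ge0 // => i _; rewrite sumr_ge0.
exists (e3 / C); first by rewrite divr_gt0.
move=> x x_near; pose z := (x - p) *m invmx B.
have z_near i : `|z 0 i - y 0 i| <= e3.
  have -> : z 0 i - y 0 i = ((x - (p + y *m B)) *m invmx B) 0 i.
    by rewrite opprD addrA mulmxBl mulmxK // [in RHS]mxE [in X in _ = _ + X]mxE.
  rewrite mxE; apply: le_trans (ler_norm_sum _ _ _) _.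
  apply: (@le_trans _ _ (\sum_j e3 / C * `|invmx B j i|)).
    apply: ler_sum => j _; rewrite normrM ler_wpM2r //.
    by rewrite mxE [X in _ + X]mxE ltW // x_near.
  rewrite -mulr_sumr mulrAC ler_pdivrMr // ler_pM2l //.
  rewrite /C [X in 1 + X](bigD1 i) //= addrCA lerDl addr_ge0 // sumr_ge0 // => j _.
  by rewrite sumr_ge0.
have z_ge0 i : 0 <= z 0 i.
  have := z_near i; rewrite ler_norml => /andP [z_ge _].
  have : e3 <= y 0 i by rewrite ge_min e1_le.
  by move: z_ge; lra.
have z_le1 : \sum_i z 0 i / s i <= 1.
  apply: (@le_trans _ _ (\sum_i (y 0 i / s i + e2 / s i))).
    apply: ler_sum => i _; rewrite -mulrDl ler_pM2r ?invr_gt0 //.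
    have := z_near i; rewrite ler_norml => /andP [_ z_le].
    have : e3 <= e2 by rewrite ge_min lexx orbT.
    by move: z_le; lra.
  rewrite big_split /= -mulr_sumr -lerBrDl /e2 mulrAC ler_pdivrMr //.
  by rewrite ler_wpM2l ?subr_ge0 ?(ltW y_lt1) // /S lerDr.
have -> : x = p + z *m B by rewrite mulmxKV // addrC subrK.
exact: simplex_sub z_le1.
Qed.

(** The segment from the inner point [c] to [z] can be prolonged inside the cylinder, to a point
    lying over some [y] of [P]. The mixture of [c] and [y] in the matching ratio is inner and lies
    over [z]. *)
Lemma inner_plus_line P c w z :
  convex_closed P -> inner P c ->
  inner (fun x => exists y t, P y /\ x = y + t *: w) z ->
  exists t, inner P (z + t *: w).
Proof.
move=> cvxP Pc /(inner_extend (z - c)) [t t_gt0 [y [a [Py yE]]]].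
have t1_gt0 : 0 < 1 + t by rewrite ltr_pwDl // ltW.
exists (- (a / (1 + t))).
have -> : z + - (a / (1 + t)) *: w =
    (t / (1 + t)) *: c + (1 - t / (1 + t)) *: y.
  have {yE} -> : y = z + t *: (z - c) - a *: w by rewrite yE addrK.
  apply/rowP => i; rewrite !mxE; field; exact: lt0r_neq0.
apply: inner_mix => //; rewrite divr_gt0 //= ler_pdivrMr // mul1r; lra.
Qed.

End Convexity.

(** * Independence modulo a line *)

Section Independence.
Variables (F : archiRealFieldType) (d : nat) (w : 'rV[F]_d).

(** Affine independence of the images of [u] in the quotient by the span of [w]. *)
Definition indep_mod (I : finType) (u : I -> 'rV[F]_d) :=
  forall (l : I -> F) mu, \sum_i l i = 0 -> \sum_i l i *: u i = mu *: w ->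
    forall i, l i = 0.

(** Caratheodory step: a multiple of an affine dependence is added until a first weight vanishes.
    The dependence is chosen nonnegative at [i0], so the weight of [i0] does not decrease. *)
Lemma dependence_drop (I : finType) (i0 : I) (u : I -> 'rV[F]_d) (c : I -> F) :
  (forall i, 0 < c i) -> ~ indep_mod u ->
  exists (c' : I -> F) (mu : F) (i1 : I),
    [/\ forall i, 0 <= c' i, 0 < c' i0, c' i1 = 0, \sum_i c' i = \sum_i c i &
        \sum_i c' i *: u i = \sum_i c i *: u i + mu *: w].
Proof.
move=> c_gt0 dep.
have [l [mu [l_sum l_comb l_neq0 l_i0]]] : exists (l : I -> F) mu,
    [/\ \sum_i l i = 0, \sum_i l i *: u i = mu *: w,
        exists i, l i != 0 & 0 <= l i0].
  have [l [mu [l_sum l_comb l_neq0]]] : exists (l : I -> F) mu,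
    [/\ \sum_i l i = 0, \sum_i l i *: u i = mu *: w & exists i, l i != 0].
    apply: contrapT => none; apply: dep => l mu l_sum l_comb i.
    apply/eqP; case: eqVneq => // l_i; case: none; exists l, mu; split=> //.
    by exists i.
  have [l_ge0|l_lt0] := leP 0 (l i0); first by exists l, mu.
  exists (fun i => - l i), (- mu); split.
  - by rewrite sumrN l_sum oppr0.
  - by under eq_bigr do rewrite scaleNr; rewrite sumrN l_comb scaleNr.
  - by case: l_neq0 => i; exists i; rewrite oppr_eq0.
  - by rewrite oppr_ge0 ltW.
have [i l_i] : exists i, l i < 0.
  apply: contrapT => none; case: l_neq0 => i /eqP; apply.
  have l_ge0 j : 0 <= l j by rewrite leNgt; apply/negP => ?; apply: none; exists j.
  exact: (@psumr_eq0P _ _ predT l (fun j _ => l_ge0 j) l_sum i isT).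
have [i1 /= l_i1 min_i1] := @Order.TotalTheory.arg_minP _ _ _ i (fun i => l i < 0)
  (fun i => c i / - l i) l_i.
pose t := c i1 / - l i1.
have t_gt0 : 0 < t by rewrite divr_gt0 // oppr_gt0.
exists (fun i => c i + t * l i), (t * mu), i1; split.
- move=> j; have [l_ge0|l_lt0] := leP 0 (l j).
    exact: addr_ge0 (ltW (c_gt0 j)) (mulr_ge0 (ltW t_gt0) l_ge0).
  have := min_i1 _ l_lt0; rewrite -/t ler_pdivlMr ?oppr_gt0 //.
  by rewrite mulrN; lra.
- exact: ltr_pwDl (c_gt0 i0) (mulr_ge0 (ltW t_gt0) l_i0).
- by rewrite /t invrN mulrN mulNr divfK ?subrr // lt_eqF.
- by rewrite big_split /= -mulr_sumr l_sum mulr0 addr0.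
- under eq_bigr do rewrite scalerDl -scalerA.
  by rewrite big_split /= -scaler_sumr l_comb scalerA.
Qed.

(** Induction on the number of positive weights, after restriction to their indices. The index [i0]
    must survive: it will be that of [p], the end of the long segment. *)
Lemma caratheodory_mod (I : finType) (i0 : I) (u : I -> 'rV[F]_d) (c : I -> F) :
  (forall i, 0 <= c i) -> 0 < c i0 ->
  exists (J : finType) (f : J -> I) (j0 : J) (c' : J -> F) (mu : F),
    [/\ f j0 = i0, forall j, 0 < c' j, \sum_j c' j = \sum_i c i,
        \sum_j c' j *: u (f j) = \sum_i c i *: u i + mu *: w &
        indep_mod (u \o f)].
Proof.
have [n] := ubnP #|[pred i | 0 < c i]|.
elim: n I i0 u c => // n IHn I i0 u c lt_n c_ge0 c_i0.
pose J := {i | i \in [pred i | 0 < c i]}.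
have i0P : i0 \in [pred i | 0 < c i] by [].
pose j0 : J := Sub i0 i0P.
have cJ_gt0 (j : J) : 0 < c (val j) by have := valP j.
have c0 i : ~~ (0 < c i) -> c i = 0.
  by move=> c_i; apply/eqP; rewrite eq_le c_ge0 andbT leNgt.
have sumJ : \sum_(j : J) c (val j) = \sum_i c i.
  rewrite -(big_sub [pred i | 0 < c i]) [RHS](bigID [pred i | 0 < c i]) /=.
  by rewrite [X in _ = _ + X]big1 ?addr0 // => i /c0.
have combJ : \sum_(j : J) c (val j) *: u (val j) = \sum_i c i *: u i.
  rewrite -(big_sub [pred i | 0 < c i] (fun i => c i *: u i)).
  rewrite [RHS](bigID [pred i | 0 < c i]) /=.
  by rewrite [X in _ = _ + X]big1 ?addr0 // => i /c0 ->; rewrite scale0r.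
case: (pselect (indep_mod (u \o (val : J -> I)))) => [ind|dep].
  by exists J, val, j0, (c \o val), 0; rewrite scale0r addr0.
have [c' [mu [j1 [c'_ge0 c'_j0 c'_j1 c'_sum c'_comb]]]] :=
  @dependence_drop J j0 _ (c \o val) cJ_gt0 dep.
have lt_card : (#|[pred j | (0 < c' j)%R]| < n)%N.
  rewrite -ltnS; apply: leq_ltn_trans lt_n.
  rewrite -[X in (_ <= X)%N]card_sig.
  apply: proper_card; apply/properP; split; first exact: subset_predT.
  by exists j1; rewrite !inE // c'_j1 ltxx.
have [K [f [k0 [c2 [mu2 [fk0 c2_gt0 c2_sum c2_comb ind]]]]]] :=
  IHn J j0 (u \o val) c' lt_card c'_ge0 c'_j0.
exists K, (val \o f), k0, c2, (mu + mu2); split=> //=.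
- by rewrite fk0.
- by rewrite c2_sum c'_sum.
- by rewrite c2_comb c'_comb combJ scalerDl addrA.
Qed.

(** Homogeneous coordinates: the last column records the sum of the coefficients and the last row is
    the direction [w], so that independence modulo a nonzero [w] becomes independence of rows. *)
Definition indep_matrix (J : finType) (u : J -> 'rV[F]_d) : 'M[F]_(#|J| + 1, d + 1) :=
  block_mx (\matrix_(a < #|J|) u (enum_val a)) (const_mx 1) w 0.

Lemma mul_indep_matrix (J : finType) (u : J -> 'rV[F]_d) (l : J -> F) (mu : F) :
  row_mx (\row_a l (enum_val a)) mu%:M *m indep_matrix u =
  row_mx (\sum_j l j *: u j + mu *: w) (\sum_j l j)%:M.
Proof.
have enum_bij : {on predT, bijective (@enum_val J predT)} by exact/onW_bij/enum_val_bij.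
rewrite /indep_matrix mul_row_block mulmx0 addr0 mul_scalar_mx; congr row_mx.
  rewrite mulmx_sum_row; congr (_ + _); rewrite [RHS](reindex _ enum_bij) /=.
  by apply: eq_bigr => a _; rewrite rowK mxE.
apply/matrixP => i j; rewrite !ord1 !mxE eqxx mulr1n [RHS](reindex _ enum_bij) /=.
by apply: eq_bigr => a _; rewrite !mxE mulr1.
Qed.

Lemma indep_row_free (J : finType) (u : J -> 'rV[F]_d) :
  w != 0 -> indep_mod u -> row_free (indep_matrix u).
Proof.
move=> w_neq0 ind; rewrite -kermx_eq0; apply/rowV0P => v /sub_kermxP.
rewrite -[v]hsubmxK [rsubmx v]mx11_scalar.
set mu := rsubmx v 0 0; set l := lsubmx v.
have -> : l = \row_a l 0 (enum_rank (enum_val a)).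
  by apply/rowP => a; rewrite [RHS]mxE enum_valK.
rewrite (mul_indep_matrix u (fun j => l 0 (enum_rank j))) -row_mx0 => /eq_row_mx [comb sum].
have {}sum : \sum_j l 0 (enum_rank j) = 0.
  by move/matrixP/(_ 0 0): sum; rewrite !mxE eqxx mulr1n.
have {}l0 : forall j, l 0 (enum_rank j) = 0.
  apply: (ind _ (- mu)) => //; apply/eqP; rewrite scaleNr -addr_eq0; exact/eqP.
have /eqP : mu *: w = 0.
  by move: comb; rewrite big1 ?add0r // => j _; rewrite l0 scale0r.
rewrite scaler_eq0 (negbTE w_neq0) orbF => /eqP ->.
rewrite raddf0 -[RHS]row_mx0; congr row_mx.
by apply/rowP => a; rewrite [LHS]mxE [RHS]mxE l0.
Qed.

Lemma indep_card (J : finType) (u : J -> 'rV[F]_d) :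
  w != 0 -> indep_mod u -> (#|J| <= d)%N.
Proof.
move=> w_neq0 /(indep_row_free w_neq0); rewrite /row_free => /eqP rk.
by rewrite -(leq_add2r 1) -[X in (X <= _)%N]rk rank_leq_col.
Qed.

Definition integral_row n (x : 'rV[F]_n) := forall i, x 0 i \is a Num.int.

(** [Num.floor] carries the integral data to the rationals; the pseudo-inverse of [M], a right
    inverse because the rows are free, recovers [x] from [x *m M]. *)
Lemma rational_solution (m n : nat) (M : 'M[F]_(m, n)) (x : 'rV[F]_m) :
  row_free M -> (forall i j, M i j \is a Num.int) -> integral_row (x *m M) ->
  exists q : 'rV[rat]_m, x = map_mx ratr q.
Proof.
move=> M_free M_int xM_int.
pose MQ : 'M[rat]_(m, n) := map_mx (intr \o Num.floor) M.
have ME : M = map_mx ratr MQ.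
  by apply/matrixP => i j; rewrite !mxE /= ratr_int floorK.
have xE : x *m M = map_mx ratr (map_mx (intr \o Num.floor) (x *m M) : 'rV[rat]_n).
  by apply/rowP => i; rewrite [RHS]mxE [X in ratr X]mxE /= ratr_int floorK.
exists (map_mx (intr \o Num.floor) (x *m M) *m pinvmx MQ).
rewrite map_mxM map_pinvmx -xE -ME -mulmxA mulmxVp ?mulmx1 //.
Qed.

Lemma common_denominator (J : finType) (q : J -> rat) :
  (forall j, 0 < q j) ->
  exists (N : nat) (X : J -> nat),
    (0 < N)%N /\ forall j, q j = (X j)%:R / N%:R.
Proof.
move=> q_gt0; pose D := \prod_j denq (q j).
have D_gt0 : 0 < D by rewrite prodr_gt0.
have DE : D = `|D|%N by rewrite gez0_abs // ltW.
exists `|D|%N, (fun j => absz (numq (q j) * \prod_(k | k != j) denq (q k))%R).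
split=> [|j]; first by rewrite absz_gt0 gt_eqF.
have num_gt0 : 0 < numq (q j) * \prod_(k | k != j) denq (q k).
  by rewrite mulr_gt0 ?numq_gt0 // prodr_gt0.
have -> : `|D|%N%:R = D%:~R :> rat by rewrite {2}DE.
rewrite -[_%:R]/(Posz _)%:~R gez0_abs ?ltW // intrM -{1}(divq_num_den (q j)).
have -> : D = denq (q j) * \prod_(k | k != j) denq (q k) by rewrite /D (bigD1 j).
rewrite intrM -mulf_div divff ?mulr1 //.
by rewrite intr_eq0 gt_eqF // prodr_gt0.
Qed.

(** The weights together with -mu solve the integral linear system of [indep_matrix] with right-hand
    side (z, 1). *)
Lemma indep_rational (J : finType) (u : J -> 'rV[F]_d) (x : J -> F) (z : 'rV[F]_d) mu :
  w != 0 -> indep_mod u -> integral_row w -> (forall j, integral_row (u j)) ->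
  integral_row z -> (forall j, 0 < x j) -> \sum_j x j = 1 ->
  \sum_j x j *: u j = z + mu *: w ->
  exists (N : nat) (X : J -> nat), (0 < N)%N /\ forall j, x j = (X j)%:R / N%:R.
Proof.
move=> w_neq0 ind w_int u_int z_int x_gt0 x_sum x_comb.
have M_free := indep_row_free w_neq0 ind.
have [||q qE] := rational_solution (x := row_mx (\row_a x (enum_val a)) (- mu)%:M) M_free.
- move=> i j; rewrite /indep_matrix mxE; case: split => k; rewrite mxE; case: split => k' //.
  + by rewrite mxE; exact: u_int.
  + by rewrite mxE rpred1.
  + by rewrite ord1; exact: w_int.
  + by rewrite mxE rpred0.
- rewrite mul_indep_matrix x_comb x_sum scaleNr addrK => i.
  rewrite mxE; case: split => k; first exact: z_int.
  by rewrite mxE !ord1 eqxx rpred1.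
pose r j := q 0 (lshift 1 (enum_rank j)).
have xE j : x j = ratr (r j).
  have /rowP/(_ (lshift 1 (enum_rank j))) := qE.
  by rewrite row_mxEl mxE enum_rankK => ->; rewrite mxE.
have [j|N [X [N_gt0 rE]]] := @common_denominator J r.
  by rewrite -(ltr0q F) -xE.
exists N, X; split=> // j.
by rewrite xE rE fmorph_div /= !ratr_nat.
Qed.

End Independence.

(** * Fibers of lattice-free polytopes *)

Section LatticeFree.
Variables (F : archiRealFieldType) (d m : nat).
Variables (P : 'rV[F]_d -> Prop) (V : 'I_m -> 'rV[F]_d).
Hypothesis cvxP : convex_closed P.
Hypothesis PV : forall k, P (V k).
Hypothesis V_int : forall k, integral_row (V k).
Hypothesis P_hull : forall x, P x ->
  exists c : 'I_m -> F, [/\ forall k, 0 <= c k, \sum_k c k = 1 & x = \sum_k c k *: V k].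
Hypothesis P_free : forall z, integral_row z -> ~ inner P z.

(** For small [e] the weights x' - e x are nonnegative, so the new point is, modulo [w], a mixture
    of the given inner point, with weight [e], and a point of [P]. *)
Lemma inner_positive_comb (J : finType) (u : J -> 'rV[F]_d) (x x' : J -> F) w a :
  (forall j, P (u j)) -> (forall j, 0 < x j) -> \sum_j x j = 1 ->
  (forall j, 0 < x' j) -> \sum_j x' j = 1 ->
  inner P (\sum_j x j *: u j + a *: w) ->
  exists b, inner P (\sum_j x' j *: u j + b *: w).
Proof.
move=> Pu x_gt0 x_sum x'_gt0 x'_sum inn.
have [e1 e1_gt0 e1_le] := positive_lower_bound x'_gt0.
pose e := Num.min e1 (2^-1).
have e_gt0 : 0 < e by rewrite lt_min e1_gt0 invr_gt0 ltr0n.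
have e_le j : e <= x' j by rewrite ge_min e1_le.
have e_lt1 : e < 1 by rewrite gt_min; apply/orP; right; lra.
have x_le1 j : x j <= 1.
  by rewrite -x_sum (bigD1 j) //= lerDl sumr_ge0 // => i _; exact: ltW.
pose q := \sum_j ((x' j - e * x j) / (1 - e)) *: u j.
have Pq : P q.
  apply: cvxP => // [j|].
    rewrite divr_ge0 ?subr_ge0 ?(ltW e_lt1) //; apply: le_trans (e_le j).
    by rewrite ler_piMr // ltW.
  rewrite -mulr_suml sumrB x'_sum -mulr_sumr x_sum mulr1 divff //.
  by rewrite gt_eqF // subr_gt0.
exists (e * a).
have -> : \sum_j x' j *: u j + (e * a) *: w =
    e *: (\sum_j x j *: u j + a *: w) + (1 - e) *: q.
  rewrite scalerDr scalerA addrAC; congr (_ + _).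
  rewrite !scaler_sumr -big_split /=; apply: eq_bigr => j _.
  rewrite !scalerA -scalerDl; congr (_ *: _); field.
  by rewrite gt_eqF // subr_gt0.
by apply: inner_mix => //; rewrite e_gt0 ltW.
Qed.

Lemma inner_open_segment p w b l t :
  inner P (p + b *: w) -> P p -> P (p + l *: w) -> 0 < t < l -> inner P (p + t *: w).
Proof.
move=> inn Pp Pl /andP [t_gt0 t_lt].
have [lt_bt|lt_tb|<- //] := ltgtP b t.
- have lb : 0 < l - b by lra.
  have -> : p + t *: w = ((l - t) / (l - b)) *: (p + b *: w) +
      (1 - (l - t) / (l - b)) *: (p + l *: w).
    by apply/rowP => i; rewrite !mxE; field; rewrite gt_eqF.
  apply: inner_mix => //; rewrite divr_gt0 ?lb ?subr_gt0 //=.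
  by rewrite ler_pdivrMr // mul1r; lra.
- have b_gt0 : 0 < b by exact: lt_trans t_gt0 lt_tb.
  have -> : p + t *: w = (t / b) *: (p + b *: w) + (1 - t / b) *: p.
    by apply/rowP => i; rewrite !mxE; field; rewrite gt_eqF.
  apply: inner_mix => //; rewrite divr_gt0 //=.
  by rewrite ler_pdivrMr // mul1r; lra.
Qed.

Lemma integral_rowD n (x y : 'rV[F]_n) :
  integral_row x -> integral_row y -> integral_row (x + y).
Proof. by move=> xi yi i; rewrite mxE rpredD. Qed.

Lemma integral_rowZ n (a : F) (x : 'rV[F]_n) :
  a \is a Num.int -> integral_row x -> integral_row (a *: x).
Proof. by move=> ai xi i; rewrite mxE rpredM. Qed.

Lemma integral_row_sum n (I : finType) (x : I -> 'rV[F]_n) :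
  (forall i, integral_row (x i)) -> integral_row (\sum_i x i).
Proof. by move=> xi j; rewrite summxE rpred_sum // => i _; exact: xi. Qed.

(** Replacing [p] by p + l w in the combination shifts it by [x j0 * l] along [w]. The fiber over
    [z'] thus contains a segment of that length, whose relative interior is inner to [P] and so free
    of integral points. *)
Lemma sylvester_fiber p w l z t0 :
  integral_row p -> P p -> integral_row w -> w != 0 -> 0 < l -> P (p + l *: w) ->
  integral_row z -> inner P (z + t0 *: w) ->
  exists (J : finType) (j0 : J) (u : J -> 'rV[F]_d) (x : J -> F) z' t,
    [/\ [/\ u j0 = p, forall j, P (u j), forall j, integral_row (u j),
            indep_mod w u & (#|J| <= d)%N],
        [/\ forall j, 0 < x j, \sum_j x j = 1, integral_row z' &
            \sum_j x j *: u j = z' + t *: w],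
        forall n, n \is a Num.int -> ~ (t < n < t + x j0 * l),
        1 <= x j0 * (sprod #|J|.-1)%:R &
        x j0 * (sprod #|J|.-1)%:R <= 1 ->
        exists2 s : seq J, perm_eq s (enum (predC1 j0)) &
          forall i, (i < #|J|.-1)%N -> x (nth j0 s i) = (sprod i).+1%:R^-1].
Proof.
move=> p_int Pp w_int w_neq0 l_gt0 Pl z_int inn.
(* Prolonging the segment from [p] through the inner point stays in [P] for a while, so this point
   is a convex combination where [p], indexed by [None], has the positive weight e / (1 + e). *)
have [e e_gt0 Pq] := inner_extend (z + t0 *: w - p) inn.
have [c [c_ge0 c_sum qE]] := P_hull Pq.
have e1_gt0 : 0 < 1 + e by rewrite ltr_pwDl // ltW.
pose U := oapp V p; pose c1 := oapp (fun k => c k / (1 + e)) (e / (1 + e)).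
have sum_option (W : nmodType) (G : option 'I_m -> W) :
    \sum_o G o = G None + \sum_k G (Some k).
  rewrite (bigD1 None) //=; congr (_ + _).
  rewrite (reindex_omap Some id) /=; last by case.
  by apply: eq_bigl => k; rewrite eqxx.
have c1_sum : \sum_o c1 o = 1.
  by rewrite sum_option /= -mulr_suml c_sum -mulrDl addrC divff // gt_eqF.
have c1_comb : \sum_o c1 o *: U o = z + t0 *: w.
  rewrite sum_option /=; under eq_bigr do rewrite mulrC -scalerA.
  rewrite -scaler_sumr -qE; apply/rowP => i; rewrite !mxE; field.
  by rewrite gt_eqF.
have c1_ge0 o : 0 <= c1 o.
  by case: o => [k|] /=; rewrite divr_ge0 // ltW.
have c1_gt0 : 0 < c1 None by rewrite divr_gt0.
have [J [f [j0 [y [mu [fj0 y_gt0 y_sum y_comb ind]]]]]] :=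
  caratheodory_mod w U c1_ge0 c1_gt0.
rewrite c1_sum in y_sum; rewrite c1_comb -addrA -scalerDl in y_comb.
pose u := U \o f.
have u_int j : integral_row (u j) by rewrite /u /=; case: (f j) => [k|] /=.
have Pu j : P (u j) by rewrite /u /=; case: (f j) => [k|] /=.
have [N [X [N_gt0 yE]]] :=
  indep_rational w_neq0 ind w_int u_int z_int y_gt0 y_sum y_comb.
have N_neq0 : N%:R != 0 :> F by rewrite pnatr_eq0 -lt0n.
have NV_gt0 : 0 < N%:R^-1 :> F by rewrite invr_gt0 ltr0n.
(* The point with weights X / N is integral modulo [w]. A move multiplies it by [n.+1] and adds an
   integer combination of the integral points [u j]. *)
pose good (X : J -> nat) := exists z' t, integral_row z' /\
  \sum_j ((X j)%:R / N%:R) *: u j = z' + t *: w.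
have good_step X1 X2 n (a : J -> int) : good X1 ->
    (forall j, (X2 j)%:Z = n.+1%:Z * (X1 j)%:Z + N%:Z * a j) -> good X2.
  case=> z1 [t1 [z1_int z1E]] X2E.
  exists (n.+1%:R *: z1 + \sum_j (a j)%:~R *: u j), (n.+1%:R * t1); split.
    apply: integral_rowD; first by apply: integral_rowZ; rewrite // natr_int.
    apply: integral_row_sum => j; apply: integral_rowZ; rewrite ?intr_int //.
  have -> : \sum_j ((X2 j)%:R / N%:R) *: u j =
      n.+1%:R *: (\sum_j ((X1 j)%:R / N%:R) *: u j) + \sum_j (a j)%:~R *: u j.
    rewrite scaler_sumr -big_split /=; apply: eq_bigr => j _.
    rewrite scalerA -scalerDl; congr (_ *: _).
    have -> : (X2 j)%:R = n.+1%:R * (X1 j)%:R + N%:R * (a j)%:~R :> F.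
      by rewrite -[LHS]/((X2 j)%:Z%:~R) X2E intrD !intrM.
    by field.
  by rewrite z1E scalerDr scalerA addrAC.
have goodX : good X.
  exists z, (t0 + mu); split=> //; rewrite -y_comb.
  by apply: eq_bigr => j _; rewrite yE.
have X_gt0 j : (0 < X j)%N.
  by have := y_gt0 j; rewrite yE pmulr_lgt0 // ltr0n.
have X_sum : (\sum_j X j)%N = N.
  apply/eqP; rewrite -(eqr_nat F) natr_sum; apply/eqP.
  transitivity ((\sum_j y j) * N%:R); last by rewrite y_sum mul1r.
  rewrite mulr_suml; apply: eq_bigr => j _.
  by rewrite yE divfK.
have [X' [[z' [t [z'_int z'E]]] X'_gt0 X'_sum le_N eq_N]] :=
  sylvester_reduction j0 good_step goodX X_gt0 X_sum.
pose x j : F := (X' j)%:R / N%:R.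
have x_gt0 j : 0 < x j by rewrite divr_gt0 ?ltr0n.
have x_sum : \sum_j x j = 1 by rewrite -mulr_suml -natr_sum X'_sum divff.
have xp_le b : (1 <= x j0 * b) = (N%:R <= (X' j0)%:R * b).
  by rewrite /x mulrAC ler_pdivlMr ?ltr0n // mul1r.
have px_le b : (x j0 * b <= 1) = ((X' j0)%:R * b <= N%:R).
  by rewrite /x mulrAC ler_pdivrMr ?ltr0n // mul1r.
exists J, j0, u, x, z', t; split.
- by split; rewrite // ?/u /= ?fj0 //; apply: indep_card ind.
- by [].
- move=> n n_int /andP [lt_tn lt_nt].
  have inn_y : inner P (\sum_j y j *: u j + (- mu) *: w).
    by rewrite y_comb -addrA -scalerDl addrK.
  have [b inn_x] := inner_positive_comb Pu y_gt0 y_sum x_gt0 x_sum inn_y.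
  have Px : P (\sum_j x j *: u j) by apply: cvxP => // j; exact: ltW.
  have Pxl : P (\sum_j x j *: u j + (x j0 * l) *: w).
    have -> : \sum_j x j *: u j + (x j0 * l) *: w =
        \sum_j x j *: (if j == j0 then p + l *: w else u j).
      rewrite (bigD1 j0) //= [RHS](bigD1 j0) //= eqxx {1}/u /= fj0 /=.
      rewrite [in RHS]scalerDr scalerA addrAC; congr (_ + _).
      by apply: eq_bigr => j /negbTE ->.
    by apply: cvxP => // j; [exact: ltW | case: ifP].
  have : inner P (\sum_j x j *: u j + (n - t) *: w).
    by apply: inner_open_segment inn_x Px Pxl _; lra.
  rewrite z'E -addrA -scalerDl [t + _]addrC subrK => /P_free; apply.
  by apply: integral_rowD => //; apply: integral_rowZ.
- by rewrite xp_le -natrM ler_nat.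
- rewrite px_le -natrM ler_nat => /eq_N [s s_perm sE]; exists s => // i /sE {}sE.
  rewrite /x -sE natrM invfM mulrA divff ?mul1r //.
  by rewrite pnatr_eq0 -lt0n.
Qed.

End LatticeFree.

(** * Maximal lattice-free simplices *)

Lemma small_step (F : archiRealFieldType) (I : finType) (a b : I -> F) :
  (forall i, 0 < a i) -> exists2 t, 0 < t & forall i, 0 < a i + t * b i.
Proof.
move=> a_gt0.
have b_gt0 i : 0 < 1 + `|b i| by rewrite ltr_pwDl.
have [i|t t_gt0 t_le] := @positive_lower_bound F I (fun i => a i / (1 + `|b i|)).
  by rewrite divr_gt0.
exists t => // i; have := t_le i; rewrite ler_pdivlMr //.
have : - `|t * b i| <= t * b i by rewrite lerNl -normrN ler_norm.
rewrite normrM (gtr0_norm t_gt0); lra.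
Qed.

Section MaximalSimplex.
Variables (F : archiRealFieldType) (d : nat).
Variables (P : 'rV[F]_d -> Prop) (p : 'rV[F]_d) (B : 'M[F]_d) (s : 'I_d -> F).
Hypothesis cvxP : convex_closed P.
Hypothesis P_free : forall z, integral_row z -> ~ inner P z.
Hypothesis p_int : integral_row p.
Hypothesis B_int : forall i j, B i j \is a Num.int.
Hypothesis B_unit : B \in unitmx.
Hypothesis s_gt0 : forall i, 0 < s i.
Hypothesis s_sum : \sum_i (s i)^-1 = 1.
Hypothesis Pp : P p.
Hypothesis Ps : forall i, P (p + s i *: row i B).

Lemma integral_row_mul (y : 'rV[F]_d) : integral_row y -> integral_row (y *m B).
Proof. by move=> y_int i; rewrite mxE rpred_sum // => j _; rewrite rpredM. Qed.

(** Integer shifts bring the coordinates into the interval from 0 (excluded) to 1 (included). A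
    non-integral one ends below 1, so the weighted sum is less than sum 1 / s = 1 and an integral
    point is inner. Hence the rows of [B] form a basis of the lattice. *)
Lemma integral_coordinates (g : 'rV[F]_d) :
  integral_row g -> integral_row (g *m invmx B).
Proof.
move=> g_int i; apply: contrapT => y_i; pose y := g *m invmx B.
pose c : 'rV[F]_d := \row_j (1 - (Num.ceil (y 0 j))%:~R).
have yc_gt0 j : 0 < (y + c) 0 j.
  rewrite mxE [c 0 j]mxE; have /andP [] := ceil_itv (y 0 j).
  by rewrite intrB; lra.
have yc_le1 j : (y + c) 0 j <= 1.
  rewrite mxE [c 0 j]mxE; have /andP [] := ceil_itv (y 0 j); lra.
have yc_lt1 : (y + c) 0 i < 1.
  rewrite lt_neqAle yc_le1 andbT; apply/eqP => E; apply: y_i.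
  have -> : (g *m invmx B) 0 i = (Num.ceil (y 0 i))%:~R.
    by move: E; rewrite mxE [c 0 i]mxE /y; lra.
  exact: intr_int.
have sum_lt1 : \sum_j (y + c) 0 j / s j < 1.
  rewrite -s_sum (bigD1 i) //= [ltRHS](bigD1 i) //= ltr_leD //.
    by rewrite -[ltRHS]mul1r ltr_pM2r ?invr_gt0.
  by apply: ler_sum => j _; rewrite -[leRHS]mul1r ler_pM2r ?invr_gt0.
apply: (@P_free (p + (y + c) *m B)); last exact: inner_simplex sum_lt1.
rewrite mulmxDl mulmxKV //; do 2![apply: integral_rowD => //].
by apply: integral_row_mul => j; rewrite mxE rpredB ?rpred1 ?intr_int.
Qed.

(** The integral point of coordinates [c] is a mixture of [v] and a point in the interior of the
    simplex, so it would be inner to [P]. *)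
Lemma integral_point_inner (v c : 'rV[F]_d) (t : F) (y := (v - p) *m invmx B) :
  P v -> integral_row c -> 0 < t -> (forall i, 0 < (c + t *: (c - y)) 0 i) ->
  \sum_i (c + t *: (c - y)) 0 i / s i < 1 -> False.
Proof.
move=> Pv c_int t_gt0 q_gt0 q_lt1.
have inn := inner_simplex cvxP B_unit s_gt0 Pp Ps q_gt0 q_lt1.
have t1_gt0 : 0 < 1 + t by rewrite ltr_pwDl // ltW.
apply: (@P_free (p + c *m B)).
  by apply: integral_rowD => //; apply: integral_row_mul.
have vE : v = p + y *m B by rewrite mulmxKV // addrC subrK.
have -> : p + c *m B = (1 + t)^-1 *: (p + (c + t *: (c - y)) *m B) +
    (1 - (1 + t)^-1) *: v.
  rewrite {1}vE mulmxDl -scalemxAl mulmxBl; move: (c *m B) (y *m B) => C Y.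
  apply/rowP => i; rewrite !mxE; field.
  by rewrite gt_eqF.
by apply: inner_mix => //; rewrite invr_gt0 t1_gt0 invf_le1 //; lra.
Qed.

(* The integral points of coordinates 1,...,1 and 1,..,0,..,1 lie in the relative
   interiors of the facets of the simplex, so P cannot cross any of these. *)
Lemma simplex_maximal (v : 'rV[F]_d) (y := (v - p) *m invmx B) :
  P v -> (forall i, 0 <= y 0 i) /\ \sum_i y 0 i / s i <= 1.
Proof.
have qE (c : 'rV[F]_d) t j : (c + t *: (c - y)) 0 j = c 0 j + t * (c - y) 0 j.
  by rewrite mxE [X in _ + X]mxE.
have dE (c : 'rV[F]_d) j : (c - y) 0 j = c 0 j - y 0 j.
  by rewrite mxE [X in _ + X]mxE.
move=> Pv; split=> [i|]; rewrite leNgt; apply/negP.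
  (* The weighted sum of [c] is 1 - 1 / s_i. The index [None] carries this slack, so a single [t]
     settles all strict inequalities; the coordinate [i] becomes - t y_i > 0. *)
  move=> y_i; pose c : 'rV[F]_d := \row_j (j != i)%:R.
  pose b := \sum_j (c - y) 0 j / s j.
  have [o|t t_gt0 t_ok] := @small_step F (option 'I_d)
      (oapp (fun=> 1) (s i)^-1) (oapp (fun j => (c - y) 0 j) (- b)).
    by case: o => [j|] /=; rewrite ?invr_gt0.
  apply: (@integral_point_inner v c t) => // [j|j|].
  - by rewrite mxE natr_int.
  - rewrite -/y qE; have /= := t_ok (Some j).
    rewrite [c 0 j]mxE; case: eqP => [-> _|//].
    by rewrite add0r mulr_gt0 // dE mxE eqxx add0r oppr_gt0.
  - rewrite -/y; under eq_bigr do rewrite qE mulrDl -mulrA.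
    rewrite big_split /= -mulr_sumr -/b.
    have -> : \sum_j c 0 j / s j = 1 - (s i)^-1.
      rewrite -s_sum (bigD1 i) //= [in RHS](bigD1 i) //= [c 0 i]mxE eqxx mul0r add0r.
      rewrite [RHS]addrC addKr; apply: eq_bigr => j ji.
      by rewrite mxE ji mul1r.
    by have /= := t_ok None; lra.
(* For the facet opposite to [p], the weighted sum of [c] is exactly 1 and decreases when moving
   away from [y]. *)
move=> y_gt1; pose c : 'rV[F]_d := const_mx 1.
have [//|t t_gt0 t_ok] := @small_step F 'I_d (fun=> 1) (fun j => (c - y) 0 j).
apply: (@integral_point_inner v c t) => // [j|j|].
- by rewrite mxE rpred1.
- by rewrite -/y qE [c 0 j]mxE.
- rewrite -/y; under eq_bigr do rewrite qE mulrDl -mulrA.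
  rewrite big_split /= -mulr_sumr.
  have -> : \sum_j c 0 j / s j = 1.
    by rewrite -[RHS]s_sum; apply: eq_bigr => j _; rewrite mxE mul1r.
  have -> : \sum_j (c - y) 0 j / s j = 1 - \sum_j y 0 j / s j.
    rewrite -[in RHS]s_sum -sumrB; apply: eq_bigr => j _.
    by rewrite dE mxE mulrBl mul1r.
  by rewrite gtrDl pmulr_rlt0 // subr_lt0.
Qed.

End MaximalSimplex.

Lemma int_num_coprime (F : archiRealFieldType) (a b : nat) (x : F) :
  coprime a b -> a%:R * x \is a Num.int -> b%:R * x \is a Num.int -> x \is a Num.int.
Proof.
move=> ab_coprime ax bx; have [u [v uv]] := Bezoutz a b.
have {}uv : u * a + v * b = 1 by rewrite uv /gcdz /= (eqP ab_coprime).
have -> : x = u%:~R * (a%:R * x) + v%:~R * (b%:R * x).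
  by rewrite !mulrA -mulrDl -![_%:R]/(_%:Z%:~R) -!intrM -intrD uv mul1r.
by rewrite rpredD // rpredM ?intr_int.
Qed.

(** Multiplying by the product [c] of the other s_j makes the sum and all other summands integral,
    hence also c times [g i]; and [c] is coprime to s_i. *)
Lemma integral_summands (F : archiRealFieldType) (d n : nat) (g : 'I_n -> 'rV[F]_d) :
  integral_row (\sum_i g i) ->
  (forall i : 'I_n, integral_row ((sprod i).+1%:R *: g i)) ->
  forall i, integral_row (g i).
Proof.
move=> sum_int g_int i k.
pose c := (\prod_(j < n | j != i) (sprod j).+1)%N.
apply: (@int_num_coprime _ (sprod i).+1 c); last 2 first.
- by have := g_int i k; rewrite mxE.
- have -> : c%:R * g i 0 k =
      c%:R * (\sum_j g j) 0 k - \sum_(j | j != i) c%:R * g j 0 k.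
    by rewrite summxE (bigD1 i) //= mulrDr mulr_sumr addrK.
  rewrite rpredB ?rpredM ?natr_int // rpred_sum // => j ji.
  rewrite /c (bigD1 j) //= natrM mulrAC rpredM ?natr_int //.
  by have := g_int j k; rewrite mxE.
- apply: (big_ind (coprime (sprod i).+1)) => [|a b|j ji]; first by rewrite coprimen1.
    by rewrite coprimeMr => -> ->.
  by apply: coprime_sylvester; rewrite eq_sym.
Qed.

(** * The bound for one lattice segment and its equality case *)

Section Bound.
Variables (F : archiRealFieldType) (n m : nat).
Variables (P : 'rV[F]_n.+1 -> Prop) (V : 'I_m -> 'rV[F]_n.+1).
Hypothesis cvxP : convex_closed P.
Hypothesis PV : forall k, P (V k).
Hypothesis V_int : forall k, integral_row (V k).
Hypothesis P_hull : forall x, P x ->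
  exists c : 'I_m -> F, [/\ forall k, 0 <= c k, \sum_k c k = 1 & x = \sum_k c k *: V k].
Hypothesis P_free : forall z, integral_row z -> ~ inner P z.
Variables (p w : 'rV[F]_n.+1) (l : F) (z : 'rV[F]_n.+1) (t0 : F).
Hypothesis p_int : integral_row p.
Hypothesis Pp : P p.
Hypothesis w_int : integral_row w.
Hypothesis w_neq0 : w != 0.
Hypothesis l_gt0 : 0 < l.
Hypothesis Pl : P (p + l *: w).
Hypothesis z_int : integral_row z.
Hypothesis z_inner : inner P (z + t0 *: w).

Lemma short_interval (t a : F) :
  (forall k, k \is a Num.int -> ~ (t < k < t + a)) -> a <= 1.
Proof.
move=> no_int; rewrite leNgt; apply/negP => a_gt1.
apply: (no_int (Num.floor t + 1)%:~R); first exact: intr_int.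
by have /andP [] := floor_itv t; rewrite intrD; lra.
Qed.

(** With k = #|J| - 1 <= n, the fiber gives x j0 * l <= 1 <= x j0 * (s_1 ... s_k). As the dimension
    d is n + 1, the bound is s_d - 1. *)
Lemma sylvester_bound : l <= (sprod n)%:R.
Proof.
have [J [j0 [u [x [z' [t [[_ _ _ _ le_J] [x_gt0 _ _ _] no_int x_ge _]]]]]]] :=
  sylvester_fiber cvxP PV V_int P_hull P_free p_int Pp w_int w_neq0 l_gt0 Pl z_int z_inner.
have x_le := short_interval no_int.
have le_p : (sprod #|J|.-1)%:R <= (sprod n)%:R :> F.
  by rewrite ler_nat leq_sprod // -ltnS; case: #|J| le_J.
rewrite -(ler_pM2l (x_gt0 j0)); apply: le_trans x_le _; apply: le_trans x_ge _.
by rewrite ler_pM2l.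
Qed.

Lemma sylvester_extremal :
  (sprod n)%:R <= l ->
  exists B : 'M[F]_n.+1,
    [/\ B \in unitmx, forall i j, B i j \is a Num.int,
        forall i : 'I_n.+1, (i < n)%N -> P (p + (sprod i).+1%:R *: row i B) &
        row ord_max B = w].
Proof.
move=> l_ge.
have [J [j0 [u [x [z' [t [[uj0 Pu u_int ind le_J] [x_gt0 x_sum z'_int x_comb] no_int x_ge x_eq]]]]]]] :=
  sylvester_fiber cvxP PV V_int P_hull P_free p_int Pp w_int w_neq0 l_gt0 Pl z_int z_inner.
have lE : l = (sprod n)%:R by apply/eqP; rewrite eq_le l_ge sylvester_bound.
have x_le := short_interval no_int.
have cardJ : #|J|.-1 = n.
  apply/eqP; rewrite eqn_leq -ltnS; apply/andP; split; first by case: #|J| le_J.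
  rewrite leqNgt; apply/negP => /ltn_sprod lt_p.
  have := lt_le_trans _ x_le; rewrite lE => /(_ (x j0 * (sprod #|J|.-1)%:R)).
  by rewrite ltr_pM2l // ltr_nat lt_p => /(_ isT); rewrite ltNge x_ge.
rewrite cardJ in x_ge x_eq; rewrite lE in x_le no_int.
have x_j0 : x j0 * (sprod n)%:R = 1 by apply/eqP; rewrite eq_le x_le x_ge.
have [s s_perm xE] := x_eq x_le.
have s_size : size s = n by rewrite (perm_size s_perm) -cardE cardC1.
have s_uniq : uniq s by rewrite (perm_uniq s_perm) enum_uniq.
have sum_J (W : nmodType) (G : J -> W) :
    \sum_j G j = G j0 + \sum_(i < n) G (nth j0 s i).
  rewrite (bigD1 j0) //=; congr (_ + _).
  transitivity (\sum_(j <- enum (predC1 j0)) G j); first by rewrite big_enum.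
  rewrite -(perm_big _ s_perm) /= (big_nth j0) s_size.
  by rewrite big_mkord.
pose v i := u (nth j0 s i).
pose f i := (sprod i).+1%:R^-1 *: (v i - p).
(* The open interval from t to t + 1 contains no integer. *)
have t_int : t \is a Num.int.
  rewrite intrEceil; case: eqVneq => // t_nint; exfalso.
  apply: (no_int (Num.ceil t)%:~R); first exact: intr_int.
  have /andP [] := ceil_itv t; rewrite intrB x_j0 le_eqVlt eq_sym (negbTE t_nint) /=.
  by move=> ? ->; rewrite /=; lra.
have f_sum : \sum_(i < n) f i = z' + t *: w - p.
  rewrite -x_comb sum_J uj0.
  have -> : x j0 = 1 - \sum_(i < n) x (nth j0 s i) by rewrite -x_sum sum_J addrK.
  rewrite scalerBl scale1r scaler_suml addrAC [p - _]addrC addrK addrC -sumrB.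
  apply: eq_bigr => i _; rewrite xE // /f scalerBr; congr (_ - _).
have f_int : forall i : 'I_n, integral_row (f i).
  apply: integral_summands => [|i].
    rewrite f_sum -scaleN1r; apply: integral_rowD.
      by apply: integral_rowD => //; apply: integral_rowZ.
    by apply: integral_rowZ; rewrite ?rpredN ?rpred1.
  rewrite /f scalerA divff ?pnatr_eq0 // scale1r -scaleN1r.
  apply: integral_rowD; first exact: u_int.
  by apply: integral_rowZ; rewrite ?rpredN ?rpred1.
pose B := \matrix_(i < n.+1) (if (i < n)%N then f i else w).
have rowB i : row i B = if (i < n)%N then f i else w by rewrite rowK.
exists B; split.
- rewrite -row_free_unit -kermx_eq0; apply/rowV0P => y /sub_kermxP.
  rewrite mulmx_sum_row big_ord_recr /= rowB ltnn.
  pose y' i := y 0 (inord i : 'I_n.+1) / (sprod i).+1%:R.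
  rewrite (eq_bigr (fun i : 'I_n => y' i *: (v i - p))); last first.
    move=> i _; rewrite rowB /= ltn_ord /f scalerA; congr ((y 0 _ / _) *: _).
    by apply: val_inj; rewrite /= inordK // ltnS ltnW.
  move=> y_comb.
  (* A linear relation between the rows of [B] becomes an affine one modulo [w] once [p] is given
     minus the sum of the other coefficients. *)
  pose l' j := if j == j0 then - \sum_(i < n) y' i else y' (index j s).
  have j0s : j0 \notin s by rewrite (perm_mem s_perm) mem_enum inE /= eqxx.
  have l'E (i : 'I_n) : l' (nth j0 s i) = y' i.
    rewrite /l' ifN; first by rewrite index_uniq // s_size.
    by apply: contra j0s => /eqP <-; rewrite mem_nth // s_size.
  have l'_0 : forall j, l' j = 0.
    apply: (ind l' (- y 0 ord_max)).
      rewrite sum_J; under eq_bigr do rewrite l'E.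
      by rewrite /l' eqxx addNr.
    rewrite sum_J; under eq_bigr do rewrite l'E.
    rewrite /l' eqxx uj0.
    have <- : \sum_(i < n) y' i *: (v i - p) = - y 0 ord_max *: w.
      by apply/eqP; rewrite scaleNr -addr_eq0 y_comb.
    rewrite scaleNr addrC scaler_suml -sumrB; apply: eq_bigr => i _.
    by rewrite scalerBr.
  have y'_0 (i : 'I_n) : y' i = 0 by rewrite -l'E.
  have y_max : y 0 ord_max = 0.
    move: y_comb; rewrite big1 ?add0r; last by move=> i _; rewrite y'_0 scale0r.
    by move/eqP; rewrite scaler_eq0 (negbTE w_neq0) orbF => /eqP.
  apply/rowP => i; rewrite [RHS]mxE; have [lt_in|le_ni] := ltnP i n.
    have /eqP := y'_0 (Ordinal lt_in); rewrite /y' mulf_eq0 invr_eq0 pnatr_eq0 orbF.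
    by rewrite /= inord_val => /eqP.
  by have -> : i = ord_max by apply: val_inj => /=; have := ltn_ord i; lia.
- move=> i j; rewrite mxE; case: ifP => [lt_in|_]; last exact: w_int.
  exact: (f_int (Ordinal lt_in)).
- move=> i lt_in; rewrite rowB lt_in /f scalerA divff ?pnatr_eq0 // scale1r.
  by rewrite addrC subrK; apply: Pu.
- by rewrite rowB ltnn.
Qed.

End Bound.

(** * Transfer to the real line of the standard library *)

(** Measured from the smallest value in units of the smallest gap, the values have distinct integer
    parts, so the largest is at least k - 1. In [lattice_line] two closest points give the integral
    direction [w], and the extreme ones the long segment. *)
Lemma minimal_gap (F : archiRealFieldType) k (t : 'I_k -> F) :
  (1 < k)%N -> injective t ->
  exists i j i0 i1 : 'I_k, t j < t i /\ k.-1%:R * (t i - t j) <= t i1 - t i0.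
Proof.
move=> k_gt1 t_inj.
have k_gt0 : (0 < k)%N by exact: ltnW.
pose o0 := Ordinal k_gt0; pose o1 := Ordinal k_gt1.
have t01 : t o0 != t o1 by apply/eqP => /t_inj.
have [q0 q0P] : exists q : 'I_k * 'I_k, t q.2 < t q.1.
  by move: t01; rewrite neq_lt => /orP [] ?; [exists (o1, o0) | exists (o0, o1)].
have [[i j] /= lt_ji min_ij] := @Order.TotalTheory.arg_minP _ _ _ q0
  (fun q : 'I_k * 'I_k => t q.2 < t q.1) (fun q => t q.1 - t q.2) q0P.
have [i0 _ min_i0] := @Order.TotalTheory.arg_minP _ _ _ o0 predT t isT.
have [i1 _ max_i1] := @Order.TotalTheory.arg_maxP _ _ _ o0 predT t isT.
exists i, j, i0, i1; split=> //.
set g := t i - t j; have g_gt0 : 0 < g by rewrite subr_gt0.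
pose r h := (t h - t i0) / g.
have r_ge0 h : 0 <= r h by rewrite divr_ge0 ?subr_ge0 ?min_i0 // ltW.
have r_le h : r h <= r i1 by rewrite ler_pM2r ?invr_gt0 // lerD2r; exact: max_i1.
have tr_lt h : (Num.truncn (r h) < (Num.truncn (r i1)).+1)%N.
  by rewrite ltnS truncn_le_nat (le_lt_trans (r_le h)) // truncnS_gt.
pose phi h : 'I_(Num.truncn (r i1)).+1 := Ordinal (tr_lt h).
have phi_inj : injective phi.
  suff W a b : t a < t b -> phi a <> phi b.
    move=> a b E; have [lt_ab|lt_ba|/t_inj //] := ltgtP (t a) (t b).
      by case: (W _ _ lt_ab).
    by case: (W _ _ lt_ba).
  move=> lt_ab /(congr1 val) /= E.
  have /= := min_ij (b, a) lt_ab; rewrite -/g => g_le.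
  have : 1 <= r b - r a.
    by rewrite -mulrBl ler_pdivlMr // mul1r opprB addrA subrK.
  have /andP [ra _] := truncn_itv (r_ge0 a); have /andP [_ rb] := truncn_itv (r_ge0 b).
  by move: ra rb; rewrite E -[(Num.truncn (r b)).+1%:R]natr1; lra.
have := leq_card phi phi_inj; rewrite !card_ord => k_le.
rewrite -ler_pdivlMr //; apply: le_trans (_ : (Num.truncn (r i1))%:R <= _).
  by rewrite ler_nat -ltnS prednK.
by have /andP [] := truncn_itv (r_ge0 i1).
Qed.

Section Transfer.
Variable d : nat.
Implicit Types (x y : vec d) (P : vec d -> Prop).

Definition rowv x : 'rV[R]_d := \row_i x i.
Definition vecr (x : 'rV[R]_d) : vec d := fun i => x 0 i.

Lemma rowvK x : vecr (rowv x) = x.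
Proof. by apply/funext => i; rewrite /vecr mxE. Qed.

Lemma vecrK (x : 'rV[R]_d) : rowv (vecr x) = x.
Proof. by apply/rowP => i; rewrite mxE. Qed.

Lemma rowv_inj : injective rowv.
Proof. exact: can_inj rowvK. Qed.

Lemma sumRE n (f : 'I_n -> R) : sumR f = \sum_i f i.
Proof. by []. Qed.

Lemma int_IZR (a : R) : (exists k : Z, a = IZR k) <-> a \is a Num.int.
Proof.
split=> [[[|k|k] ->]|a_int].
- by rewrite rpred0.
- by rewrite IZRposE INRE natr_int.
- by rewrite -Pos2Z.opp_pos opp_IZR IZRposE INRE RoppE rpredN natr_int.
- rewrite -(floorK a_int); case: (Num.floor a) => k.
    by exists (Z.of_nat k); rewrite -INR_IZR_INZ INRE.
  exists (Z.opp (Z.of_nat k.+1)).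
  by rewrite opp_IZR -INR_IZR_INZ INRE RoppE NegzE rmorphN.
Qed.

Lemma integralE x : integral x <-> integral_row (rowv x).
Proof.
split=> x_int i; first by rewrite mxE; apply/int_IZR; exact: x_int.
by apply/int_IZR; have := x_int i; rewrite mxE.
Qed.

Lemma convE m (V : 'I_m -> vec d) x :
  conv V x <-> exists c : 'I_m -> R,
    [/\ forall k, 0 <= c k, \sum_k c k = 1 & rowv x = \sum_k c k *: rowv (V k)].
Proof.
split=> [[c [c_ge0 [c_sum xE]]] | [c [c_ge0 c_sum xE]]]; exists c.
  split=> // [k|]; first exact/RleP.
  apply/rowP => i; rewrite mxE xE sumRE summxE.
  by apply: eq_bigr => k _; rewrite !mxE.
split=> [k|]; first exact/RleP.
split=> // i; have /rowP/(_ i) := xE; rewrite mxE summxE => ->.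
by apply: eq_bigr => k _; rewrite !mxE.
Qed.

Lemma convex_closed_conv m (V : 'I_m -> vec d) :
  convex_closed (conv V \o vecr).
Proof.
move=> I c u c_ge0 c_sum Pu.
have {Pu} /fin_all_exists [w wP] i : exists w : 'I_m -> R,
    [/\ forall k, 0 <= w k, \sum_k w k = 1 & u i = \sum_k w k *: rowv (V k)].
  by have := Pu i; rewrite /= convE vecrK.
rewrite /= convE vecrK; exists (fun k => \sum_i c i * w i k); split.
- by move=> k; rewrite sumr_ge0 // => i _; rewrite mulr_ge0 //; have [] := wP i.
- rewrite exchange_big /= -[RHS]c_sum; apply: eq_bigr => i _.
  by rewrite -mulr_sumr; have [_ -> _] := wP i; rewrite mulr1.
- under [RHS]eq_bigr do rewrite scaler_suml.
  rewrite exchange_big /=; apply: eq_bigr => i _.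
  have [_ _ ->] := wP i; rewrite scaler_sumr.
  by apply: eq_bigr => k _; rewrite scalerA.
Qed.

Lemma interiorE P x : interiorRd P x <-> inner (P \o vecr) (rowv x).
Proof.
split=> [[e [/RltP e_gt0 Pe]] | [e e_gt0 Pe]]; exists e => //.
  move=> y y_near; apply: Pe => i; apply/RltP.
  by have := y_near i; rewrite mxE /vecr RealsE.
split; first exact/RltP.
move=> y y_near; rewrite -[y]rowvK; apply: Pe => i; rewrite !mxE.
by have /RltP := y_near i; rewrite RealsE.
Qed.

Lemma full_dimensional_inner P :
  convex_closed (P \o vecr) -> full_dimensional P -> exists c, inner (P \o vecr) c.
Proof.
move=> cvxP [p [Pp p_indep]].
pose B : 'M[R]_d := \matrix_(i < d) (rowv (p (lift ord0 i)) - rowv (p ord0)).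
have d_gt0 : 0 < d.+1%:R :> R by rewrite ltr0n.
(* The barycenter of the d + 1 points. *)
exists (rowv (p ord0) + const_mx (d.+1%:R^-1) *m B).
apply: (@inner_simplex _ _ _ _ _ (fun=> 1)) => //.
- rewrite -row_free_unit -kermx_eq0; apply/rowV0P => y /sub_kermxP yB.
  pose l k := oapp (fun i => y 0 i) (- \sum_i y 0 i) (unlift ord0 k).
  have l0 : l ord0 = - \sum_i y 0 i by rewrite /l unlift_none.
  have lS i : l (lift ord0 i) = y 0 i by rewrite /l liftK.
  have l_eq0 : forall k, l k = 0.
    apply: p_indep => [|j].
      by rewrite sumRE big_ord_recl; under eq_bigr do rewrite lS; rewrite l0 addNr.
    have /rowP/(_ j) := yB; rewrite [RHS]mxE => yB_j; rewrite -[RHS]yB_j.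
    rewrite -[LHS]/(\sum_k l k * p k j) big_ord_recl; under eq_bigr do rewrite lS.
    rewrite l0 mulNr mulr_suml addrC -sumrB [RHS]mxE.
    by apply: eq_bigr => i _; rewrite !mxE mulrBr.
  by apply/rowP => i; rewrite -lS l_eq0 mxE.
- by rewrite /= rowvK.
- by move=> i; rewrite rowK scale1r addrC subrK /= rowvK.
- by move=> i; rewrite mxE invr_gt0.
- under eq_bigr do rewrite mxE divr1.
  by rewrite sumr_const card_ord -[ltLHS]mulr_natl ltr_pdivrMr // mul1r ltr_nat.
Qed.

Lemma rowv_affine (A : 'I_d -> 'I_d -> R) (b x : vec d) :
  rowv (affine_map A b x) = rowv x *m (\matrix_(j, i) A i j) + rowv b.
Proof.
apply/rowP => i; rewrite !mxE /affine_map sumRE; congr (_ + _).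
by apply: eq_bigr => j _; rewrite !mxE mulrC.
Qed.

Lemma integral_rational_dir (x y : vec d) :
  integral x -> integral y -> x <> y -> rational_dir (vecr (rowv y - rowv x)).
Proof.
move=> x_int y_int neq; split=> [i|].
  have [a aE] := x_int i; have [b bE] := y_int i.
  exists (QArith_base.inject_Z (Z.sub b a)); rewrite /vecr !mxE aE bE.
  by rewrite /Q2R /= minus_IZR Rinv_1 Rmult_1_r.
apply: contrapT => none; apply: neq; apply/funext => i.
apply: contrapT => neq; apply: none; exists i; rewrite /vecr !mxE => /eqP.
by rewrite subr_eq0 => /eqP /esym.
Qed.

End Transfer.

Arguments rowv {d} x.
Arguments vecr {d} x.

Lemma lattice_line d (P : vec d -> Prop) (a u : vec d) k (pts : 'I_k -> vec d) :
  (1 < k)%N -> lattice_points_on P a u pts ->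
  exists (p w : 'rV[R]_d) (l c : R),
    [/\ [/\ integral_row p, (P \o vecr) p & (P \o vecr) (p + l *: w)],
        integral_row w, w != 0, c != 0 & w = c *: rowv u] /\ k.-1%:R <= l.
Proof.
move=> k_gt1 [pts_inj ptsP].
have {}ptsP j : exists t, [/\ integral (pts j), P (pts j) & rowv (pts j) = rowv a + t *: rowv u].
  have [? [? [t tE]]] := ptsP j; exists t; split=> //.
  by apply/rowP => i; rewrite !mxE tE.
have {ptsP} [t tP] := fin_all_exists ptsP.
have t_inj : injective t.
  move=> i j E; apply/pts_inj/rowv_inj.
  by have [_ _ ->] := tP i; have [_ _ ->] := tP j; rewrite E.
have [i [j [i0 [i1 [lt_ji le_l]]]]] := minimal_gap k_gt1 t_inj.
have g_gt0 : 0 < t i - t j by rewrite subr_gt0.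
have rowB h h' : rowv (pts h) - rowv (pts h') = (t h - t h') *: rowv u.
  have [_ _ ->] := tP h; have [_ _ ->] := tP h'.
  by rewrite opprD addrACA subrr add0r -scalerBl.
exists (rowv (pts i0)), (rowv (pts i) - rowv (pts j)), ((t i1 - t i0) / (t i - t j)), (t i - t j).
split; last by rewrite ler_pdivlMr.
have int_pts h : integral_row (rowv (pts h)) by apply/integralE; have [] := tP h.
have P_pts h : P (pts h) by have [] := tP h.
split=> //.
- split=> //; first by rewrite /= rowvK.
  rewrite rowB scalerA divfK ?gt_eqF // -rowB addrC subrK /= rowvK //.
- by rewrite -scaleN1r; apply: integral_rowD => //; apply: integral_rowZ; rewrite ?rpredN ?rpred1.
- rewrite subr_eq0; apply/eqP => /rowv_inj/pts_inj E.
  by rewrite E ltxx in lt_ji.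
- by rewrite gt_eqF.
Qed.

(** * The extremal simplex *)

Section S0.
Variable n : nat.

Definition S0_scale (i : 'I_n.+1) : R :=
  if (i < n)%N then (sprod i).+1%:R else (sprod n)%:R.

Lemma S0_scale_gt0 i : 0 < S0_scale i.
Proof. by rewrite /S0_scale; case: ifP; rewrite ltr0n ?sprod_gt0. Qed.

Lemma S0_scale_sum : \sum_i (S0_scale i)^-1 = 1.
Proof.
rewrite big_ord_recr /= {2}/S0_scale ltnn.
rewrite (eq_bigr (fun i : 'I_n => (sprod i).+1%:R^-1)); last first.
  by move=> i _; rewrite /S0_scale /= ltn_ord.
by rewrite sum_inv_sylvester subrK.
Qed.

Lemma sylvesterS : sylvester n.+1 = (sprod n).+1.
Proof. by rewrite /sylvester subn1 addn1. Qed.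

Lemma S0_vertex0 i : S0_vertex n.+1 ord0 i = 0.
Proof. by []. Qed.

Lemma S0_vertexS k i :
  S0_vertex n.+1 (lift ord0 k) i = (k == i)%:R * S0_scale i.
Proof.
rewrite /S0_vertex /=.
case: (eqVneq k i) => [->|ki]; last first.
  by rewrite -[eqn k i]/((k : nat) == i) (inj_eq val_inj) (negbTE ki) mul0r.
rewrite -[eqn i i]/((i : nat) == i) eqxx mul1r /S0_scale.
have [lt_in|le_ni] := ltnP i n.
  rewrite -[eqn i n]/((i : nat) == n) ltn_eqF // INRE.
  by rewrite /sylvester subn1 addn1.
have -> : i = n :> nat by have := ltn_ord i; lia.
by rewrite -[eqn n n]/(n == n) eqxx INRE sylvesterS subn1.
Qed.

(** The barycentric coordinates are the y_i / [S0_scale i], the origin taking the rest. This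
    description by inequalities matches [simplex_maximal]. *)
Lemma S0E (y : vec n.+1) :
  S0 n.+1 y <-> (forall i, 0 <= y i) /\ \sum_i y i / S0_scale i <= 1.
Proof.
rewrite /S0 convE; split=> [[c [c_ge0 c_sum yE]]|[y_ge0 y_le1]].
  have {}yE i : y i = c (lift ord0 i) * S0_scale i.
    have /rowP/(_ i) := yE; rewrite mxE summxE big_ord_recl !mxE S0_vertex0 mulr0 add0r => ->.
    rewrite (bigD1 i) //= !mxE S0_vertexS eqxx mul1r big1 ?addr0 // => k ki.
    by rewrite !mxE S0_vertexS (negbTE ki) mul0r mulr0.
  split=> [i|]; first by rewrite yE mulr_ge0 // ltW ?S0_scale_gt0.
  rewrite (eq_bigr (fun i => c (lift ord0 i))); last first.
    by move=> i _; rewrite yE mulfK // gt_eqF ?S0_scale_gt0.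
  by move: c_sum; rewrite big_ord_recl => <-; rewrite lerDr.
pose c k := oapp (fun i => y i / S0_scale i) (1 - \sum_i y i / S0_scale i) (unlift ord0 k).
have c0 : c ord0 = 1 - \sum_i y i / S0_scale i by rewrite /c unlift_none.
have cS i : c (lift ord0 i) = y i / S0_scale i by rewrite /c liftK.
exists c; split.
- move=> k; case: (unliftP ord0 k) => [i|] ->.
    by rewrite cS divr_ge0 // ltW ?S0_scale_gt0.
  by rewrite c0 subr_ge0.
- by rewrite big_ord_recl; under eq_bigr do rewrite cS; rewrite c0 subrK.
apply/rowP => i; rewrite mxE summxE big_ord_recl !mxE S0_vertex0 mulr0 add0r.
rewrite (bigD1 i) //= !mxE S0_vertexS eqxx mul1r cS divfK ?gt_eqF ?S0_scale_gt0 //.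
rewrite big1 ?addr0 // => k ki.
by rewrite !mxE S0_vertexS (negbTE ki) mul0r mulr0.
Qed.

End S0.

Lemma inner_along_line d (P : vec d -> Prop) (u : vec d) (z : vec d) :
  convex_closed (P \o vecr) -> full_dimensional P -> interiorRd (plus_line P u) z ->
  exists t, inner (P \o vecr) (rowv z + t *: rowv u).
Proof.
move=> cvxP fullP /interiorE [e e_gt0 Pe].
have [c Pc] := full_dimensional_inner cvxP fullP.
apply: (inner_plus_line cvxP Pc); exists e => // x /Pe [y [t [Py xE]]].
exists (rowv y), t; split; first by rewrite /= rowvK.
by apply/rowP => i; have := xE i; rewrite /vecr !mxE => ->.
Qed.

(** The edge of [S0] along e_d carries the s_d points 0, e_d, ..., (s_d - 1) e_d, which are pulled
    back by the equivalence. *)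
Lemma ld_ge_S0 n (P : vec n.+1 -> Prop) :
  unimod_equiv P (S0 n.+1) -> ld_ge P (sylvester n.+1 - 1).
Proof.
case=> A [b [f_inj [f_surj [f_int PS]]]]; set f := affine_map A b in f_inj f_surj f_int PS.
have nE : (sylvester n.+1 - 1 + 1 = (sprod n).+1)%N by rewrite sylvesterS subn1 addn1.
rewrite /ld_ge nE.
pose y (t : R) : vec n.+1 := fun i => if i == ord_max then t else 0.
have /fin_all_exists [x xP] (j : 'I_(sprod n).+1) : exists x, P x /\ f x = y j%:R.
  apply/PS/S0E; split=> [i|]; first by rewrite /y; case: ifP.
  rewrite (bigD1 ord_max) //= big1 ?addr0; last first.
    by move=> i /negbTE ni; rewrite /y ni mul0r.
  rewrite /y eqxx /S0_scale ltnn ler_pdivrMr ?ltr0n ?sprod_gt0 // mul1r ler_nat.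
  by rewrite -ltnS ltn_ord.
have y_inj s t : y s = y t -> s = t.
  by move/(congr1 (fun v : vec n.+1 => v ord_max)); rewrite /y eqxx.
have x_inj : injective x.
  move=> i j E; apply/val_inj/eqP; rewrite -(eqr_nat R); apply/eqP/y_inj.
  by have [_ <-] := xP i; have [_ <-] := xP j; rewrite E.
have x_int j : integral (x j).
  apply/f_int; have [_ ->] := xP j; apply/integralE => i.
  by rewrite mxE /y; case: ifP; rewrite ?natr_int ?rpred0.
have lt1 : (1 < (sprod n).+1)%N by rewrite ltnS sprod_gt0.
pose o1 := Ordinal lt1; pose u := vecr (rowv (x o1) - rowv (x ord0)).
exists (x ord0), u, x; split.
  apply: integral_rational_dir => // /x_inj /(congr1 val) //.
split=> // j; split=> //; split; first by have [] := xP j.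
exists (j%:R : R) => i.
suff -> : x j = vecr (rowv (x ord0) + j%:R *: rowv u).
  by rewrite /vecr !mxE.
(* Collinearity is checked on the images, which are the points j e_d. *)
apply: f_inj; apply: rowv_inj.
have fE k : rowv (f (x k)) = rowv (y k%:R) by have [_ ->] := xP k.
rewrite fE rowv_affine vecrK mulmxDl -scalemxAl /u vecrK mulmxBl.
have := fE ord0; have := fE o1; rewrite !rowv_affine.
move: (_ *m _) (rowv b) => g1 b' E1.
move: (_ *m _) => g0 E0.
have -> : g1 - g0 = rowv (y 1) - rowv (y 0) by rewrite -E1 -E0 opprD addrACA subrr addr0.
rewrite addrAC E0; apply/rowP => k; rewrite !mxE /y; case: ifP => _ /=.
  by rewrite add0r subr0 mulr1.
by rewrite subr0 mulr0 addr0.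
Qed.

(** * Lattice diameter of the polytope *)

Section LatticeFreePolytope.
Variables (n : nat) (P : vec n.+1 -> Prop).
Hypothesis hpoly : lattice_polytope P.
Hypothesis hdim : full_dimensional P.
Hypothesis hfree : forall z : vec n.+1, integral z -> ~ interiorRd P z.
Hypothesis hlines : forall u : vec n.+1, rational_dir u ->
  exists z : vec n.+1, integral z /\ interiorRd (plus_line P u) z.

Let cvxP : convex_closed (P \o vecr).
Proof.
have [m [V [_ PE]]] := hpoly.
have -> : P = conv V by apply/funext => x; apply/propext.
exact: convex_closed_conv.
Qed.

Let P_free : forall z, integral_row z -> ~ inner (P \o vecr) z.
Proof.
move=> z z_int inn; apply: (hfree (z := vecr z)).
  by apply/integralE; rewrite vecrK.
by apply/interiorE; rewrite vecrK.
Qed.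

Let hull_P : exists m (V : 'I_m -> 'rV[R]_n.+1),
  [/\ forall k, (P \o vecr) (V k), forall k, integral_row (V k) &
      forall x, (P \o vecr) x <-> exists c : 'I_m -> R,
        [/\ forall k, 0 <= c k, \sum_k c k = 1 & x = \sum_k c k *: V k]].
Proof.
have [m [V [V_int PE]]] := hpoly; exists m, (rowv \o V); split.
- move=> k; rewrite /= rowvK PE convE; exists (fun j => (j == k)%:R); split.
  + by move=> j; rewrite ler0n.
  + by rewrite (bigD1 k) //= eqxx big1 ?addr0 // => j /negbTE ->.
  + rewrite (bigD1 k) //= eqxx scale1r big1 ?addr0 // => j /negbTE ->.
    by rewrite scale0r.
- by move=> k; apply/integralE.
- by move=> x; rewrite /= PE convE vecrK.
Qed.

Let inner_along (a u : vec n.+1) k (pts : 'I_k -> vec n.+1) :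
  rational_dir u -> (1 < k)%N -> lattice_points_on P a u pts ->
  exists (p w : 'rV[R]_n.+1) (l : R) (z : 'rV[R]_n.+1) (t0 : R),
    [/\ [/\ integral_row p, (P \o vecr) p & (P \o vecr) (p + l *: w)],
        integral_row w /\ w != 0, integral_row z,
        inner (P \o vecr) (z + t0 *: w) & k.-1%:R <= l /\ 0 < l].
Proof.
move=> u_rat k_gt1 /(lattice_line k_gt1).
case=> p [w [l [c [[pP w_int w_neq0 c_neq0 wE] le_l]]]].
have [z [z_int /(inner_along_line cvxP hdim) [t inn]]] := hlines u_rat.
exists p, w, l, (rowv z), (t / c); split=> //; first exact/integralE.
  by rewrite wE scalerA divfK.
split=> //; apply: lt_le_trans le_l; rewrite ltr0n; by case: k k_gt1 {pts} => [|[]].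
Qed.

Lemma ld_le_sylvester : ld_le P (sylvester n.+1 - 1).
Proof.
move=> a u u_rat k pts pts_on; rewrite sylvesterS subn1 /=.
have [k_le1|k_gt1] := leqP k 1; first by apply: leq_trans k_le1 _; rewrite leq_addl.
have [p [w [l [z [t0 [[p_int Pp Pl] [w_int w_neq0] z_int inn [le_l l_gt0]]]]]]] :=
  inner_along u_rat k_gt1 pts_on.
have [m [V [PV V_int P_hull]]] := hull_P.
have hullP x : (P \o vecr) x -> _ := proj1 (P_hull x).
have l_le := sylvester_bound cvxP PV V_int hullP P_free p_int Pp w_int w_neq0 l_gt0 Pl z_int inn.
have := le_trans le_l l_le; rewrite ler_nat addn1; lia.
Qed.

(** Here l = s_d - 1, so [P] contains the simplex spanned at [p] by the scaled rows of [B]. The map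
    x -> (x - p) B^-1 preserves the lattice by [integral_coordinates], and [simplex_maximal] shows
    that [P] is no larger than this simplex. *)
Lemma ld_ge_unimod : ld_ge P (sylvester n.+1 - 1) -> unimod_equiv P (S0 n.+1).
Proof.
case=> a [u [pts [u_rat pts_on]]].
have k_gt1 : (1 < sylvester n.+1 - 1 + 1)%N.
  by rewrite sylvesterS subn1 addn1 ltnS sprod_gt0.
have [p [w [l [z [t0 [[p_int Pp Pl] [w_int w_neq0] z_int inn [le_l l_gt0]]]]]]] :=
  inner_along u_rat k_gt1 pts_on.
have [m [V [PV V_int P_hull]]] := hull_P.
have hullP x : (P \o vecr) x -> _ := proj1 (P_hull x).
have l_le := sylvester_bound cvxP PV V_int hullP P_free p_int Pp w_int w_neq0 l_gt0 Pl z_int inn.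
rewrite sylvesterS subn1 addn1 /= in le_l.
have lE : l = (sprod n)%:R by apply/eqP; rewrite eq_le l_le le_l.
have [B [B_unit B_int PB rowB]] := sylvester_extremal cvxP PV V_int hullP P_free p_int
  Pp w_int w_neq0 l_gt0 Pl z_int inn le_l.
have Ps i : (P \o vecr) (p + S0_scale i *: row i B).
  rewrite /S0_scale; have [lt_in|le_ni] := ltnP i n; first exact: PB.
  have -> : i = ord_max by apply: val_inj => /=; have := ltn_ord i; lia.
  by rewrite rowB -lE.
have Bi_int := integral_coordinates cvxP P_free p_int B_int B_unit (@S0_scale_gt0 n)
  (S0_scale_sum n) Pp Ps.
have max_P := simplex_maximal cvxP P_free p_int B_int B_unit (@S0_scale_gt0 n)
  (S0_scale_sum n) Pp Ps.
(* Transposed, because [affine_map] acts on columns and [B] on rows. *)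
pose A i j := invmx B j i; pose b := vecr (- (p *m invmx B)).
exists A, b; set f := affine_map A b.
have fE x : rowv (f x) = (rowv x - p) *m invmx B.
  rewrite rowv_affine vecrK mulmxBl; congr (_ *m _ - _).
  by apply/matrixP => i j; rewrite mxE.
have gE y : f (vecr (p + rowv y *m B)) = y.
  by apply: rowv_inj; rewrite fE vecrK addrC addKr mulmxK.
have fK x : vecr (p + rowv (f x) *m B) = x.
  by rewrite fE mulmxKV // addrC subrK rowvK.
split; first by move=> x y fxy; rewrite -[x]fK fxy fK.
split; first by move=> y; exists (vecr (p + rowv y *m B)).
have subN (x y : 'rV[R]_n.+1) : integral_row x -> integral_row y -> integral_row (x - y).
  by move=> xi yi i; rewrite !mxE rpredB ?xi ?yi.
split=> [x|y].
  split=> /integralE x_int; apply/integralE.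
    by rewrite fE; apply: Bi_int; apply: subN.
  rewrite -[x]fK vecrK; apply: integral_rowD => //.
  exact: integral_row_mul.
rewrite S0E; split=> [[y_ge0 y_le1]|[x [Px <-]]].
  exists (vecr (p + rowv y *m B)); split; last exact: gE.
  apply: (simplex_sub cvxP (@S0_scale_gt0 n) Pp Ps) => [i|]; first by rewrite mxE.
  by under eq_bigr do rewrite mxE.
have fxE i : f x i = ((rowv x - p) *m invmx B) 0 i by rewrite -fE mxE.
have Prx : (P \o vecr) (rowv x) by rewrite /= rowvK.
have [y_ge0 y_le1] := max_P _ Prx.
split=> [i|]; first by rewrite fxE.
by under eq_bigr do rewrite fxE.
Qed.

End LatticeFreePolytope.

Theorem mainTheorem10 (d : nat) (hd : (1 <= d)%N) (P : vec d -> Prop)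
  (hpoly : lattice_polytope P)
  (hdim : full_dimensional P)
  (hfree : forall z : vec d, integral z -> ~ interiorRd P z)
  (hlines : forall u : vec d, rational_dir u ->
              exists z : vec d, integral z /\ interiorRd (plus_line P u) z) :
  ld_le P (sylvester d - 1) /\
  (ld_eq P (sylvester d - 1) <-> unimod_equiv P (S0 d)).
Proof.
case: d hd P hpoly hdim hfree hlines => // n _ P hpoly hdim hfree hlines.
have le_ld := ld_le_sylvester hpoly hdim hfree hlines.
split=> //; split=> [[_]|/ld_ge_S0 ge_ld]; last by split.
exact: ld_ge_unimod.
Qed.
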